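(* Let $\mathbb{G}$ be a compact quantum group with antipode $S$, and let $I_{\mathrm{Kac}}$ be the ideal of $\mathcal{O}(\mathbb{G})$ generated by the range of $S^2-\mathrm{id}$. Then $I_{\mathrm{Kac}}$ is a Hopf $*$-ideal, and the compact quantum group $\mathbb{G}_{\mathrm{Kac}}$ defined by $\mathcal{O}(\mathbb{G}_{\mathrm{Kac}})=\mathcal{O}(\mathbb{G})/I_{\mathrm{Kac}}$ is the maximal Kac type quantum subgroup of $\mathbb{G}$. Moreover, $I_{\mathrm{Kac}}$ is also the ideal generated by the union of the ranges of all the maps $\tau_s-\mathrm{id}$, $s\in\mathbb{R}$, where $(\tau_s)_{s\in\mathbb{R}}$ is the scaling group of $\mathbb{G}$.
   Context: A CQG-algebra is a Hopf $*$-algebra over $\mathbb{C}$ spanned by the coefficients of its finite-dimensional unitary corepresentations. A compact quantum group $\mathbb{G}$ is given by a CQG-algebra $\mathcal{O}(\mathbb{G})$. A quantum subgroup $\mathbb{H}$ of $\mathbb{G}$ is given by a surjective Hopf $*$-algebra morphism $\mathcal{O}(\mathbb{G})\to\mathcal{O}(\mathbb{H})$, equivalently by its kernel $\mathcal{I}_{\mathbb{H}}$, a Hopf $*$-ideal; $\mathbb{H}_1\subset\mathbb{H}_2$ means $\mathcal{I}_{\mathbb{H}_2}\subset\mathcal{I}_{\mathbb{H}_1}$. A compact quantum group is of Kac type if its antipode satisfies $S^2=\mathrm{id}$; the maximal Kac type quantum subgroup is the largest quantum subgroup of Kac type. Scaling group: to any irreducible unitary representation $U=(u_{ij})_{i,j=1}^n\in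 M_n(\mathcal{O}(\mathbb{G}))$ one associates the unique positive invertible matrix $Q$ with $\mathrm{Tr}(Q)=\mathrm{Tr}(Q^{-1})$ such that $Q\overline{U}Q^{-1}$ is unitary, where $\overline U=(u_{ij}^* )$. Conjugating $U$ by a scalar unitary matrix, one may assume $Q$ is diagonal with diagonal coefficients $q_1,\dots,q_n$. The formula $\tau_t(u_{ij})=\left(\frac{q_i}{q_j}\right)^{-it}u_{ij}$, $t\in\mathbb{R}$, consistently defines a one-parameter group $(\tau_t)_{t\in\mathbb{R}}$ of $*$-homomorphisms of $\mathcal{O}(\mathbb{G})$, called the scaling group. *)

(* Defs.v *)
From HB Require Import structures.
From mathcomp Require Import all_boot all_order all_algebra.
From mathcomp Require Import generic_quotient.
From mathcomp Require Import boolp classical_sets reals exp trigo.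
From mathcomp Require Import complex.

Set Implicit Arguments.
Unset Strict Implicit.
Unset Printing Implicit Defensive.

Import GRing.Theory.
Local Open Scope ring_scope.
Local Open Scope quotient_scope.
Local Open Scope classical_set_scope.

Reserved Notation "U '⊗' V" (at level 40, left associativity).
Reserved Notation "u '⊗t' v" (at level 40, left associativity).

(* Algebraic tensor product over a commutative ring: formal finite sums of    *)
(* pairs modulo the equations satisfied in every abelian group W under every  *)
(* biadditive map f with f (c *: u) v = f u (c *: v).  Such maps need not be  *)
(* K-bilinear, so semilinear maps such as u ⊗ v |-> u^* ⊗ v^* also factor     *)
(* through it.                                                                *)
Section Tensor.
Variable K : comNzRingType.

Section Def.
Variables U V : lmodType K.

Definition balanced (W : zmodType) (f : U -> V -> W) : Prop :=
  [/\ forall u u' v, f (u + u') v = f u v + f u' v,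
      forall u v v', f u (v + v') = f u v + f u v'
    & forall c u v, f (c *: u) v = f u (c *: v)].

Definition pairsum (W : zmodType) (f : U -> V -> W) (s : seq (U * V)) : W :=
  \sum_(p <- s) f p.1 p.2.

Definition tensor_rel (s t : seq (U * V)) : bool :=
  `[< forall (W : zmodType) (f : U -> V -> W),
        balanced f -> pairsum f s = pairsum f t >].

Lemma tensor_rel_refl : reflexive tensor_rel.
Proof. by move=> s; apply/asboolP. Qed.

Lemma tensor_rel_sym : symmetric tensor_rel.
Proof.
by move=> s t; apply/asboolP/asboolP => H W f bf; rewrite (H W f bf).
Qed.

Lemma tensor_rel_trans : transitive tensor_rel.
Proof.
move=> t s r /asboolP H1 /asboolP H2; apply/asboolP => W f bf.
by rewrite (H1 W f bf) (H2 W f bf).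
Qed.

Canonical tensor_equiv :=
  EquivRel tensor_rel tensor_rel_refl tensor_rel_sym tensor_rel_trans.

Definition tensor := {eq_quot tensor_equiv}.
HB.instance Definition _ := Choice.on tensor.
HB.instance Definition _ := EqQuotient.on tensor.

Definition tpure (u : U) (v : V) : tensor := \pi_tensor [:: (u, v)].

(* The map on tensors induced by f; meaningful when f is balanced (tliftE).   *)
Definition tlift (W : zmodType) (f : U -> V -> W) (x : tensor) : W :=
  pairsum f (repr x).

Lemma tliftE (W : zmodType) (f : U -> V -> W) s :
  balanced f -> tlift f (\pi_tensor s) = pairsum f s.
Proof.
move=> bf; rewrite /tlift; have : tensor_rel (repr (\pi_tensor s)) s.
  by apply/eqmodP; rewrite reprK.
by move/asboolP; apply.
Qed.

Lemma tensor_eqP (s t : seq (U * V)) :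
  (forall (W : zmodType) (f : U -> V -> W),
     balanced f -> pairsum f s = pairsum f t) ->
  \pi_tensor s = \pi_tensor t.
Proof. by move=> H; apply/eqmodP/asboolP. Qed.

Definition tadd (x y : tensor) : tensor := \pi_tensor (repr x ++ repr y).
Definition topp (x : tensor) : tensor :=
  \pi_tensor [seq (- p.1, p.2) | p <- repr x].
Definition tscale (c : K) (x : tensor) : tensor :=
  \pi_tensor [seq (c *: p.1, p.2) | p <- repr x].

Lemma balanced0l (W : zmodType) (f : U -> V -> W) v : balanced f -> f 0 v = 0.
Proof. by case=> fD _ _; apply: (addrI (f 0 v)); rewrite -fD !addr0. Qed.

Lemma balancedNl (W : zmodType) (f : U -> V -> W) u v :
  balanced f -> f (- u) v = - f u v.
Proof.
move=> bf; case: (bf) => fD _ _; apply: (addrI (f u v)).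
by rewrite -fD !subrr balanced0l.
Qed.

Lemma pairsum_cat (W : zmodType) (f : U -> V -> W) s t :
  pairsum f (s ++ t) = pairsum f s + pairsum f t.
Proof. by rewrite /pairsum big_cat. Qed.

Lemma pairsumN (W : zmodType) (f : U -> V -> W) s : balanced f ->
  pairsum f [seq (- p.1, p.2) | p <- s] = - pairsum f s.
Proof.
move=> bf; rewrite /pairsum big_map raddf_sum /=.
by apply: eq_bigr => p _; rewrite balancedNl.
Qed.

Lemma pairsumZ (W : zmodType) (f : U -> V -> W) c s :
  pairsum f [seq (c *: p.1, p.2) | p <- s] =
  pairsum (fun u v => f (c *: u) v) s.
Proof. by rewrite /pairsum big_map. Qed.

Lemma balancedZ (W : zmodType) (f : U -> V -> W) c :
  balanced f -> balanced (fun u v => f (c *: u) v).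
Proof.
case=> fDl fDr fZ; split=> [u u' v|u v v'|d u v].
- by rewrite scalerDr fDl.
- exact: fDr.
- by rewrite scalerA mulrC -scalerA fZ.
Qed.

Lemma tensor_ext (x y : tensor) :
  (forall (W : zmodType) (f : U -> V -> W),
     balanced f -> tlift f x = tlift f y) -> x = y.
Proof.
by move=> H; rewrite -[x]reprK -[y]reprK; apply: tensor_eqP => W f /H.
Qed.

Lemma tlift_add (W : zmodType) (f : U -> V -> W) x y :
  balanced f -> tlift f (tadd x y) = tlift f x + tlift f y.
Proof. by move=> bf; rewrite /tadd tliftE // pairsum_cat. Qed.

Lemma tlift_opp (W : zmodType) (f : U -> V -> W) x :
  balanced f -> tlift f (topp x) = - tlift f x.
Proof. by move=> bf; rewrite /topp tliftE // pairsumN. Qed.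

Lemma tlift_scale (W : zmodType) (f : U -> V -> W) c x :
  balanced f -> tlift f (tscale c x) = tlift (fun u v => f (c *: u) v) x.
Proof. by move=> bf; rewrite /tscale tliftE // pairsumZ. Qed.

Lemma tlift_zero (W : zmodType) (f : U -> V -> W) :
  balanced f -> tlift f (\pi_tensor [::]) = 0.
Proof. by move=> bf; rewrite tliftE // /pairsum big_nil. Qed.

Fact taddA : associative tadd.
Proof.
by move=> x y z; apply: tensor_ext => W f bf; rewrite !tlift_add // addrA.
Qed.

Fact taddC : commutative tadd.
Proof.
by move=> x y; apply: tensor_ext => W f bf; rewrite !tlift_add // addrC.
Qed.

Fact tadd0 : left_id (\pi_tensor [::]) tadd.
Proof.
by move=> x; apply: tensor_ext => W f bf; rewrite tlift_add // tlift_zero // add0r.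
Qed.

Fact taddN : left_inverse (\pi_tensor [::]) topp tadd.
Proof.
move=> x; apply: tensor_ext => W f bf.
by rewrite tlift_add // tlift_opp // tlift_zero // addNr.
Qed.

HB.instance Definition _ := GRing.isZmodule.Build tensor taddA taddC tadd0 taddN.

Lemma tliftD (W : zmodType) (f : U -> V -> W) : balanced f ->
  {morph tlift f : x y / x + y}.
Proof. by move=> bf x y; apply: tlift_add. Qed.

Fact tscaleA a b x : tscale a (tscale b x) = tscale (a * b) x.
Proof.
apply: tensor_ext => W f bf; rewrite !tlift_scale //; last exact: balancedZ.
by apply: eq_bigr => p _; rewrite scalerA.
Qed.

Fact tscale1 : left_id 1 tscale.
Proof.
move=> x; apply: tensor_ext => W f bf; rewrite tlift_scale //.
by apply: eq_bigr => p _; rewrite scale1r.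
Qed.

Fact tscaleDr : right_distributive tscale +%R.
Proof.
move=> c x y; apply: tensor_ext => W f bf.
by rewrite tliftD // !tlift_scale // tliftD //; apply: balancedZ.
Qed.

Fact tscaleDl x : {morph tscale^~ x : a b / a + b}.
Proof.
move=> a b; apply: tensor_ext => W f bf; rewrite tliftD // !tlift_scale //.
rewrite /tlift /pairsum -big_split; apply: eq_bigr => p _ /=.
by rewrite scalerDl; case: bf => ->.
Qed.

HB.instance Definition _ :=
  GRing.Zmodule_isLmodule.Build K tensor tscaleA tscale1 tscaleDr tscaleDl.

End Def.

Local Notation "U ⊗ V" := (tensor U V) : type_scope.
Local Notation "u ⊗t v" := (tpure u v) : ring_scope.

Lemma tlift_pure (U V : lmodType K) (W : zmodType) (f : U -> V -> W) u v :
  balanced f -> tlift f (u ⊗t v) = f u v.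
Proof. by move=> bf; rewrite /tpure tliftE // /pairsum big_seq1. Qed.

Lemma tpure_balanced (U V : lmodType K) : balanced (@tpure U V).
Proof.
split=> [u u' v|u v v'|c u v]; apply: tensor_ext => W f bf.
- by rewrite tliftD // !tlift_pure //; case: bf.
- by rewrite tliftD // !tlift_pure //; case: bf.
- by rewrite !tlift_pure //; case: bf.
Qed.

Lemma tpureZl (U V : lmodType K) c (u : U) (v : V) :
  c *: (u ⊗t v) = (c *: u) ⊗t v.
Proof.
apply: tensor_ext => W f bf; rewrite tlift_scale // !tlift_pure //.
exact: balancedZ.
Qed.

Lemma tensor_sum (U V : lmodType K) (x : U ⊗ V) :
  x = \sum_(p <- repr x) p.1 ⊗t p.2.
Proof.
rewrite -[LHS]reprK; elim: (repr x) => [|p s IH]; first by rewrite big_nil.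
rewrite big_cons -IH; apply: tensor_ext => W f bf.
by rewrite tliftD // tlift_pure // !tliftE // /pairsum big_cons.
Qed.

Lemma tensor_ind (U V : lmodType K) (P : U ⊗ V -> Prop) :
  P 0 -> (forall u v, P (u ⊗t v)) -> (forall x y, P x -> P y -> P (x + y)) ->
  forall x, P x.
Proof.
move=> P0 Pp PD x; rewrite [x]tensor_sum.
by elim/big_ind: _ => // p _; apply: Pp.
Qed.

Definition tmap (U U' V V' : lmodType K) (f : U -> U') (g : V -> V')
  : U ⊗ V -> U' ⊗ V' := tlift (fun u v => f u ⊗t g v).

Definition tassoc (U V W : lmodType K) : (U ⊗ V) ⊗ W -> U ⊗ (V ⊗ W) :=
  tlift (fun x w => tlift (fun u v => u ⊗t (v ⊗t w)) x).

Section Algebra.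
Variables A B : algType K.

Definition tmul (x y : A ⊗ B) : A ⊗ B :=
  tlift (fun a b => tlift (fun a' b' => (a * a') ⊗t (b * b')) y) x.

Lemma tmul_balanced_in a b :
  balanced (fun (a' : A) (b' : B) => (a * a') ⊗t (b * b')).
Proof.
have [tDl tDr tZ] := @tpure_balanced A B.
split=> [u u' v|u v v'|c u v]; rewrite ?mulrDr ?tDl ?tDr //.
by rewrite -!scalerAr tZ.
Qed.

Lemma tlift_eqD (U V : lmodType K) (W : zmodType) (f g h : U -> V -> W) x :
  (forall u v, f u v = g u v + h u v) -> tlift f x = tlift g x + tlift h x.
Proof.
by move=> E; rewrite /tlift /pairsum -big_split; apply: eq_bigr => p _.
Qed.

Lemma tmul_balanced_out y : balanced (fun (a : A) (b : B) =>
  tlift (fun a' b' => (a * a') ⊗t (b * b')) y).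
Proof.
have [tDl tDr tZ] := @tpure_balanced A B.
split=> [u u' v|u v v'|c u v].
- by apply: tlift_eqD => a b; rewrite mulrDl tDl.
- by apply: tlift_eqD => a b; rewrite mulrDl tDr.
- by apply: eq_bigr => p _; rewrite -!scalerAl tZ.
Qed.

Lemma tmulDl : left_distributive tmul +%R.
Proof. by move=> x y z; apply: tliftD; apply: tmul_balanced_out. Qed.

Lemma tmulDr : right_distributive tmul +%R.
Proof.
by move=> x y z; apply: tlift_eqD => a b; apply: tliftD; apply: tmul_balanced_in.
Qed.

Lemma tmul_pure a b a' b' : tmul (a ⊗t b) (a' ⊗t b') = (a * a') ⊗t (b * b').
Proof.
rewrite /tmul tlift_pure; last exact: tmul_balanced_out.
by rewrite tlift_pure //; apply: tmul_balanced_in.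
Qed.

Lemma tmul0x x : tmul 0 x = 0.
Proof. by apply: (addrI (tmul 0 x)); rewrite -tmulDl !addr0. Qed.

Lemma tmulx0 x : tmul x 0 = 0.
Proof. by apply: (addrI (tmul x 0)); rewrite -tmulDr !addr0. Qed.

Lemma tmulA : associative tmul.
Proof.
move=> x y z; elim/tensor_ind: x => [|a b|x x' Hx Hx'].
- by rewrite !tmul0x.
- elim/tensor_ind: y => [|a' b'|y y' Hy Hy'].
  + by rewrite tmul0x !tmulx0 tmul0x.
  + elim/tensor_ind: z => [|a'' b''|z z' Hz Hz'].
    * by rewrite !tmulx0.
    * by rewrite !tmul_pure !mulrA.
    * by rewrite !tmulDr Hz Hz'.
  + by rewrite tmulDl !tmulDr tmulDl Hy Hy'.
- by rewrite !tmulDl Hx Hx'.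
Qed.

Lemma tmul1x : left_id (1 ⊗t 1) tmul.
Proof.
elim/tensor_ind=> [|a b|x y Hx Hy]; first by rewrite tmulx0.
- by rewrite tmul_pure !mul1r.
- by rewrite tmulDr Hx Hy.
Qed.

Lemma tmulx1 : right_id (1 ⊗t 1) tmul.
Proof.
elim/tensor_ind=> [|a b|x y Hx Hy]; first by rewrite tmul0x.
- by rewrite tmul_pure !mulr1.
- by rewrite tmulDl Hx Hy.
Qed.

HB.instance Definition _ := GRing.Zmodule_isPzRing.Build (A ⊗ B)
  tmulA tmul1x tmulx1 tmulDl tmulDr.

End Algebra.
End Tensor.

Notation "U ⊗ V" := (tensor U V) : type_scope.
Notation "u ⊗t v" := (tpure u v) : ring_scope.

(* The last axiom says that comul is a *-homomorphism, A ⊗ A carrying the     *)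
(* involution a ⊗ b |-> a^* ⊗ b^*.                                            *)
HB.mixin Record isHopfStar (R : realType) A of GRing.Algebra R[i] A := {
  star : A -> A;
  comul : A -> A ⊗ A;
  counit : A -> R[i];
  antipode : A -> A;
  starK : involutive star;
  starD : {morph star : a b / a + b};
  starZ : forall (c : R[i]) a, star (c *: a) = (c^*)%C *: star a;
  starM : forall a b, star (a * b) = star b * star a;
  comul_linear : linear comul;
  comul_monoid_morphism : monoid_morphism comul;
  counit_linear : scalar counit;
  counit_monoid_morphism : monoid_morphism counit;
  antipode_linear : linear antipode;
  comulA : forall a, tassoc (tmap comul id (comul a)) = tmap id comul (comul a);
  counitl : forall a, tlift (fun x y => counit x *: y) (comul a) = a;
  counitr : forall a, tlift (fun x y => counit y *: x) (comul a) = a;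
  antipodel : forall a,
    tlift (fun x y => antipode x * y) (comul a) = counit a *: 1;
  antipoder : forall a,
    tlift (fun x y => x * antipode y) (comul a) = counit a *: 1;
  comul_star : forall a, comul (star a) = tmap star star (comul a)
}.

#[short(type="hopfStarType")]
HB.structure Definition HopfStar (R : realType) :=
  {A of GRing.Algebra R[i] A & isHopfStar R A}.

Section Corepresentations.
Variables (R : realType) (A : hopfStarType R).

(* The image of a scalar matrix in matrices over A. *)
Definition smx m n (M : 'M[R[i]]_(m, n)) : 'M[A]_(m, n) :=
  map_mx (fun c => c%:A) M.

Definition starmx m n (U : 'M[A]_(m, n)) : 'M[A]_(n, m) :=
  (map_mx star U)^T.

Definition unitary_mx n (U : 'M[A]_n) : Prop :=
  starmx U *m U = 1%:M /\ U *m starmx U = 1%:M.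

Definition corepresentation n (U : 'M[A]_n) : Prop :=
  (forall i j, comul (U i j) = \sum_(k < n) U i k ⊗t U k j) /\
  (forall i j, counit (U i j) = (i == j)%:R).

Definition unitary_corep n (U : 'M[A]_n) : Prop :=
  corepresentation U /\ unitary_mx U.

(* The subspace W of C^n spanned by the (linearly independent) columns of B   *)
(* is invariant: U maps W into W ⊗ A, whose elements are the B *m x with x a  *)
(* column over A.                                                             *)
Definition invariant_subspace n (U : 'M[A]_n) k (B : 'M[R[i]]_(n, k)) : Prop :=
  \rank B = k /\ exists X : 'M[A]_k, U *m smx B = smx B *m X.

Definition irreducible n (U : 'M[A]_n) : Prop :=
  (0 < n)%N /\ forall k (B : 'M[R[i]]_(n, k)),
    invariant_subspace U B -> k = 0%N \/ k = n.

Definition coefficient (a : A) : Prop :=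
  exists n (U : 'M[A]_n) i j, unitary_corep U /\ a = U i j.

(* In the order of R[i], 0 <= z means that z is real and nonnegative, so      *)
(* positivity of Q includes that it is Hermitian.                             *)
Definition positive_mx n (Q : 'M[R[i]]_n) : Prop :=
  forall v : 'cV[R[i]]_n,
    0 <= ((map_mx (@conjc R) v)^T *m Q *m v) ord0 ord0.

Definition modular_matrix n (U : 'M[A]_n) (Q : 'M[R[i]]_n) : Prop :=
  [/\ positive_mx Q, Q \in unitmx, \tr Q = \tr (invmx Q)
    & unitary_mx (smx Q *m map_mx star U *m smx (invmx Q))].

End Corepresentations.

HB.mixin Record isCQG (R : realType) A of HopfStar R A := {
  coefficient_span : forall a : A, exists2 s : seq (R[i] * A),
    (forall p, p \in s -> coefficient p.2) & a = \sum_(p <- s) p.1 *: p.2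
}.

#[short(type="cqgType")]
HB.structure Definition CQG (R : realType) := {A of HopfStar R A & isCQG R A}.

Section Ideals.
Variables (R : realType) (A : hopfStarType R).

(* Closure under scalars follows, c *: x being (c *: 1) * x. *)
Definition two_sided_ideal (I : set A) : Prop :=
  [/\ I 0, forall a b, I a -> I b -> I (a + b),
      forall a b, I b -> I (a * b) & forall a b, I a -> I (a * b)].

Definition ideal_gen (X : set A) : set A := smallest two_sided_ideal X.

(* The subspace I ⊗ A + A ⊗ I of A ⊗ A. *)
Definition ideal_tensor (I : set A) : set (A ⊗ A) :=
  [set x | exists2 s : seq (A * A),
     (forall p, p \in s -> I p.1 \/ I p.2) & x = \sum_(p <- s) p.1 ⊗t p.2].

Definition hopf_star_ideal (I : set A) : Prop :=
  [/\ two_sided_ideal I,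
      forall a, I a -> ideal_tensor I (comul a),
      forall a, I a -> counit a = 0,
      forall a, I a -> I (antipode a)
    & forall a, I a -> I (star a)].

Definition kac_ideal : set A :=
  ideal_gen (range (fun a : A => antipode (antipode a) - a)).

Definition kac_type : Prop := forall a : A, antipode (antipode a) = a.

End Ideals.

Arguments kac_ideal {R} A _ : rename.
Arguments kac_type {R} A.

Section QuantumSubgroups.
Variables (R : realType).

Definition hopf_star_morphism (A B : hopfStarType R) (f : {lrmorphism A -> B})
    : Prop :=
  [/\ forall a, f (star a) = star (f a),
      forall a, comul (f a) = tmap f f (comul a),
      forall a, counit (f a) = counit a
    & forall a, f (antipode a) = antipode (f a)].

Definition mker (A B : hopfStarType R) (f : {lrmorphism A -> B}) : set A :=
  [set a | f a = 0].

(* O(H) = B, as a quotient of O(G) = A. *)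
Definition quantum_subgroup (A B : cqgType R) (f : {lrmorphism A -> B}) : Prop :=
  hopf_star_morphism f /\ forall b, exists a, f a = b.

(* H_1 is contained in H_2 when the kernel of O(G) -> O(H_2) is contained in  *)
(* that of O(G) -> O(H_1).                                                    *)
Definition maximal_kac (A B : cqgType R) (f : {lrmorphism A -> B}) : Prop :=
  [/\ quantum_subgroup f, kac_type B
    & forall (H : cqgType R) (g : {lrmorphism A -> H}),
        quantum_subgroup g -> kac_type H -> mker f `<=` mker g].

End QuantumSubgroups.

Section ScalingGroup.
Variables (R : realType) (A : cqgType R).

(* q ^ (- i t) for a real q > 0. *)
Definition cpow_it (q t : R) : R[i] :=
  Complex (cos (t * ln q)) (- sin (t * ln q)).

Definition scaling_group (tau : R -> {lrmorphism A -> A}) : Prop :=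
  [/\ forall t a, tau t (star a) = star (tau t a),
      forall a, tau 0 a = a,
      forall s t a, tau (s + t) a = tau s (tau t a)
    & forall n (U : 'M[A]_n) (q : 'rV[R]_n),
        unitary_corep U -> irreducible U ->
        modular_matrix U (diag_mx (map_mx (fun x => x%:C%C) q)) ->
        forall t i j,
          tau t (U i j) = cpow_it (q ord0 i / q ord0 j) t *: U i j].

End ScalingGroup.

(* Main.v *)
Require Import Defs.
From HB Require Import structures.
From mathcomp Require Import all_boot all_order all_algebra.
From mathcomp Require Import generic_quotient.
From mathcomp Require Import boolp classical_sets reals exp trigo.
From mathcomp Require Import complex spectral sesquilinear.

(** On a coefficient u_ij of a unitary corepresentation U the antipode is
    S(u_ij) = u_ji^*, both sides being the inverse of U, and such coefficients
    span the algebra. This gives the compatibility of S with products, coproducts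
    and the involution (antipodeM, comul_antipode, star_antipode_star_antipode),
    so S^2 is a Hopf algebra automorphism and star exchanges it with its inverse.
    The ideal generated by the S^2 a - a is then a Hopf *-ideal
    (kac_hopf_star_ideal). The quotient inherits all the structure, S^2 is the
    identity on it, and a morphism to a Hopf *-algebra with S^2 = id kills every
    S^2 a - a; this is the maximality of the quotient (kac_maximal).

    For the comparison with the scaling group, it suffices to know that the
    algebra is spanned by coefficients u_ij of irreducible unitary
    corepresentations having a diagonal modular matrix Q = diag(q_i)
    (modular_ind). For these, S^2 multiplies u_ij by (q_i / q_j)^2 and tau_t
    multiplies it by (q_i / q_j)^(-it). Both ideals are therefore generated by
    the u_ij with q_i <> q_j (scaling_ideal).

    That spanning property combines two facts. First, a unitary corepresentation
    is a direct sum of irreducible ones (irreducible_ind), since the orthogonal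
    complement of an invariant subspace is invariant. Second, every
    corepresentation is equivalent to a unitary one (corep_unitarizable); for the
    conjugate of U this yields a positive matrix which, diagonalised and rescaled,
    is the square of Q (modular_diagonalization). In place of the Haar state,
    unitarizability is proved by averaging over the finite-dimensional *-algebra
    of matrices f(W), with f ranging over the linear forms on A and W a fixed
    unitary corepresentation. *)

Set Implicit Arguments.
Unset Strict Implicit.
Unset Printing Implicit Defensive.

Import Order.TTheory GRing.Theory Num.Theory.
Local Open Scope ring_scope.
Local Open Scope classical_set_scope.

(** * Tensor products and the antipode on unitary coefficients *)

Section Bilinear.
Variable K : comNzRingType.

Lemma tlift0 (U V : lmodType K) (W : zmodType) (f : U -> V -> W) :
  balanced f -> tlift f 0 = 0.
Proof. by move=> bf; apply: (addrI (tlift f 0)); rewrite -tliftD ?addr0. Qed.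

Lemma tpureZr (U V : lmodType K) c (u : U) (v : V) :
  c *: (u ⊗t v) = u ⊗t (c *: v).
Proof. by have [_ _ <-] := @tpure_balanced K U V; apply: tpureZl. Qed.

Lemma tpure0l (U V : lmodType K) (v : V) : (0 : U) ⊗t v = 0.
Proof. by rewrite -(scale0r 0) -tpureZl scale0r. Qed.

Lemma tpure0r (U V : lmodType K) (u : U) : u ⊗t (0 : V) = 0.
Proof. by rewrite -(scale0r 0) -tpureZr scale0r. Qed.

Lemma tpure_suml (U V : lmodType K) (I : finType) (F : I -> U) (v : V) :
  (\sum_i F i) ⊗t v = \sum_i F i ⊗t v.
Proof.
have [tDl _ _] := @tpure_balanced K U V.
apply: (big_morph (fun u => u ⊗t v)) => [u u'|]; first by rewrite tDl.
exact: tpure0l.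
Qed.

Lemma tpure_sumr (U V : lmodType K) (I : finType) (u : U) (F : I -> V) :
  u ⊗t (\sum_i F i) = \sum_i u ⊗t F i.
Proof.
have [_ tDr _] := @tpure_balanced K U V.
apply: (big_morph (fun v => u ⊗t v)) => [v v'|]; first by rewrite tDr.
exact: tpure0r.
Qed.

Lemma balanced_pure (U V U' V' : lmodType K) (f : {linear U -> U'})
    (g : {linear V -> V'}) : balanced (fun u v => f u ⊗t g v).
Proof.
have [tDl tDr tZ] := @tpure_balanced K U' V'.
by split=> *; rewrite ?linearD ?linearZ /= ?tDl ?tDr ?tZ.
Qed.

Lemma tmap_pure (U V U' V' : lmodType K) (f : {linear U -> U'})
    (g : {linear V -> V'}) u v : tmap f g (u ⊗t v) = f u ⊗t g v.
Proof. by rewrite /tmap tlift_pure //; apply: balanced_pure. Qed.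

Lemma tmapD (U V U' V' : lmodType K) (f : {linear U -> U'})
    (g : {linear V -> V'}) : {morph tmap f g : x y / x + y}.
Proof. by apply: tliftD; apply: balanced_pure. Qed.

Lemma tmap0 (U V U' V' : lmodType K) (f : {linear U -> U'})
    (g : {linear V -> V'}) : tmap f g 0 = 0.
Proof. by apply: tlift0; apply: balanced_pure. Qed.

Lemma tmapZ (U V U' V' : lmodType K) (f : {linear U -> U'})
    (g : {linear V -> V'}) c x : tmap f g (c *: x) = c *: tmap f g x.
Proof.
elim/tensor_ind: x => [|u v|x y Hx Hy].
- by rewrite scaler0 tmap0 scaler0.
- by rewrite tpureZl !tmap_pure linearZ tpureZl.
- by rewrite scalerDr !tmapD scalerDr Hx Hy.
Qed.

Fact tmap_linear (U V U' V' : lmodType K) (f : {linear U -> U'})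
    (g : {linear V -> V'}) : linear (tmap f g).
Proof. by move=> c x y; rewrite tmapD tmapZ. Qed.

HB.instance Definition _ (U V U' V' : lmodType K) (f : {linear U -> U'})
    (g : {linear V -> V'}) := GRing.isLinear.Build K (U ⊗ V) (U' ⊗ V') *:%R
  (tmap f g) (tmap_linear f g).

(** Functoriality, in the form that carries a commutative square on each leg to
    the tensor products. *)
Lemma eq_tmap_comp (U V U1 V1 U2 V2 U' V' : lmodType K)
    (f1 : {linear U1 -> U'}) (g1 : {linear V1 -> V'})
    (h1 : {linear U -> U1}) (k1 : {linear V -> V1})
    (f2 : {linear U2 -> U'}) (g2 : {linear V2 -> V'})
    (h2 : {linear U -> U2}) (k2 : {linear V -> V2}) :
  (forall u, f1 (h1 u) = f2 (h2 u)) -> (forall v, g1 (k1 v) = g2 (k2 v)) ->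
  forall x, tmap f1 g1 (tmap h1 k1 x) = tmap f2 g2 (tmap h2 k2 x).
Proof.
move=> fh gk; elim/tensor_ind => [|u v|x y Hx Hy]; first by rewrite !tmap0.
- by rewrite !tmap_pure fh gk.
- by rewrite !tmapD Hx Hy.
Qed.

(** Naturality of the universal property: an identity between two balanced maps
    on pure tensors transports along linear maps. All the axioms of a quotient
    Hopf algebra that start from tlift are instances. *)
Lemma tlift_tmap (U V U' V' : lmodType K) (W W' : zmodType)
    (g : {linear U -> U'}) (h : {linear V -> V'})
    (f : U -> V -> W) (f' : U' -> V' -> W') (p : {additive W -> W'}) :
  balanced f -> balanced f' -> (forall u v, f' (g u) (h v) = p (f u v)) ->
  forall x, tlift f' (tmap g h x) = p (tlift f x).
Proof.
move=> bf bf' E; elim/tensor_ind => [|u v|x y Hx Hy].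
- by rewrite tmap0 !tlift0 // raddf0.
- by rewrite tmap_pure !tlift_pure.
- by rewrite tmapD !tliftD // raddfD Hx Hy.
Qed.

Section Assoc.
Variables U V W : lmodType K.

Lemma balanced_assoc_inner (w : W) : balanced (fun (u : U) (v : V) => u ⊗t (v ⊗t w)).
Proof.
have [tDl tDr tZ] := @tpure_balanced K U (V ⊗ W).
have [tDl' _ tZ'] := @tpure_balanced K V W.
by split=> *; rewrite ?tDl ?tDl' ?tDr // tZ tpureZl.
Qed.

Lemma balanced_assoc :
  balanced (fun x (w : W) => tlift (fun (u : U) (v : V) => u ⊗t (v ⊗t w)) x).
Proof.
have [_ tDr tZ] := @tpure_balanced K U (V ⊗ W).
have [_ tDr' tZ'] := @tpure_balanced K V W.
split=> [x y w|x w w'|c x w].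
- by apply: tliftD; apply: balanced_assoc_inner.
- by apply: tlift_eqD => u v; rewrite tDr' tDr.
- elim/tensor_ind: x => [|u v|x y Hx Hy].
  + by rewrite scaler0 !tlift0 //; apply: balanced_assoc_inner.
  + rewrite tpureZl !tlift_pure; try exact: balanced_assoc_inner.
    by rewrite tZ tpureZl tZ'.
  + by rewrite scalerDr !tliftD ?Hx ?Hy //; apply: balanced_assoc_inner.
Qed.

Lemma tassocD : {morph @tassoc K U V W : x y / x + y}.
Proof. exact: (tliftD balanced_assoc). Qed.

Lemma tassoc0 : tassoc (0 : (U ⊗ V) ⊗ W) = 0.
Proof. exact: (tlift0 balanced_assoc). Qed.

Lemma tassoc_pure u v w : tassoc ((u ⊗t v) ⊗t w) = u ⊗t (v ⊗t w) :> U ⊗ (V ⊗ W).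
Proof.
rewrite /tassoc tlift_pure; last exact: balanced_assoc.
by rewrite tlift_pure //; apply: balanced_assoc_inner.
Qed.
End Assoc.

Lemma tassoc_tmap (U V W U' V' W' : lmodType K) (f : {linear U -> U'})
    (g : {linear V -> V'}) (h : {linear W -> W'}) (x : (U ⊗ V) ⊗ W) :
  tassoc (tmap (tmap f g) h x) = tmap f (tmap g h) (tassoc x).
Proof.
elim/tensor_ind: x => [|u w|x y Hx Hy]; first by rewrite tmap0 !tassoc0 tmap0.
  elim/tensor_ind: u => [|u v|x y Hx Hy].
  - by rewrite tpure0l tmap0 !tassoc0 tmap0.
  - by rewrite tassoc_pure !tmap_pure /= !tmap_pure tassoc_pure.
  - have [tDl _ _] := @tpure_balanced K (U ⊗ V) W.
    by rewrite tDl tmapD !tassocD Hx Hy tmapD.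
by rewrite tmapD !tassocD Hx Hy tmapD.
Qed.

Lemma tmapM (A B A' B' : algType K) (f : {lrmorphism A -> A'})
    (g : {lrmorphism B -> B'}) : {morph tmap f g : x y / x * y}.
Proof.
move=> x y; elim/tensor_ind: x => [|a b|x x' Hx Hx'].
- by rewrite mul0r tmap0 mul0r.
- elim/tensor_ind: y => [|a' b'|y y' Hy Hy'].
  + by rewrite mulr0 tmap0 mulr0.
  + rewrite [_ * _ in LHS]tmul_pure !tmap_pure [RHS]tmul_pure.
    by rewrite !rmorphM.
  + by rewrite mulrDr !tmapD Hy Hy' mulrDr.
- by rewrite mulrDl !tmapD Hx Hx' mulrDl.
Qed.

Lemma tlift_sum_pure (U V : lmodType K) (W : zmodType) (f : U -> V -> W)
    (I : finType) (u : I -> U) (v : I -> V) : balanced f ->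
  tlift f (\sum_i u i ⊗t v i) = \sum_i f (u i) (v i).
Proof.
move=> bf; rewrite (big_morph _ (tliftD bf) (tlift0 bf)).
by apply: eq_bigr => i _; rewrite tlift_pure.
Qed.
End Bilinear.

Section HopfMaps.
Variables (R : realType) (A : hopfStarType R).

HB.instance Definition _ := GRing.isLinear.Build R[i] A (A ⊗ A) *:%R
  (@comul R A) (@comul_linear R A).
HB.instance Definition _ := GRing.isMonoidMorphism.Build A (A ⊗ A)
  (@comul R A) (@comul_monoid_morphism R A).
HB.instance Definition _ := GRing.isLinear.Build R[i] A R[i] *%R
  (@counit R A) (@counit_linear R A).
HB.instance Definition _ := GRing.isMonoidMorphism.Build A R[i]
  (@counit R A) (@counit_monoid_morphism R A).
HB.instance Definition _ := GRing.isLinear.Build R[i] A A *:%R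
  (@antipode R A) (@antipode_linear R A).
Fact star_is_zmod : zmod_morphism (@star R A).
Proof.
move=> a b; rewrite starD; congr (_ + _).
by rewrite -scaleN1r starZ rmorphN1 scaleN1r.
Qed.
HB.instance Definition _ := GRing.isZmodMorphism.Build A A (@star R A) star_is_zmod.

Lemma balanced_star : balanced (fun a b : A => star a ⊗t star b).
Proof.
have [tDl tDr tZ] := @tpure_balanced _ A A.
by split=> *; rewrite ?starD ?starZ ?tDl ?tDr ?tZ.
Qed.

Lemma balanced_antipodel : balanced (fun a b : A => antipode a * b).
Proof.
split=> *; rewrite ?raddfD ?mulrDl ?mulrDr //.
by rewrite linearZ /= -scalerAl scalerAr.
Qed.

Lemma balanced_antipoder : balanced (fun a b : A => a * antipode b).
Proof.
split=> *; rewrite ?raddfD ?mulrDl ?mulrDr //.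
by rewrite linearZ /= -scalerAr scalerAl.
Qed.

Lemma balanced_antipode_flip :
  balanced (fun a b : A => antipode b ⊗t antipode a).
Proof.
have [tDl tDr tZ] := @tpure_balanced _ A A.
by split=> *; rewrite ?raddfD ?linearZ /= ?tDl ?tDr ?tZ.
Qed.

(* Indices range over an arbitrary finite type so that the products of the
   coefficients of two corepresentations, indexed by pairs, are covered. *)
Section MatrixCoalgebra.
Variables (I : finType) (u : I -> I -> A).
Hypothesis comul_u : forall i j, comul (u i j) = \sum_k u i k ⊗t u k j.
Hypothesis counit_u : forall i j, counit (u i j) = (i == j)%:R.

Lemma coalg_antipodel i j : \sum_k antipode (u i k) * u k j = (i == j)%:R.
Proof.
have := antipodel (u i j); rewrite comul_u tlift_sum_pure; last first.
  exact: balanced_antipodel.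
by move=> ->; rewrite counit_u scaler_nat.
Qed.

Lemma coalg_antipoder i j : \sum_k u i k * antipode (u k j) = (i == j)%:R.
Proof.
have := antipoder (u i j); rewrite comul_u tlift_sum_pure; last first.
  exact: balanced_antipoder.
by move=> ->; rewrite counit_u scaler_nat.
Qed.

(** The matrix of antipodes is a left inverse of u, so it equals every right
    inverse. *)
Lemma coalg_antipode_uniq (w : I -> I -> A) :
  (forall i j, \sum_k u i k * w k j = (i == j)%:R) ->
  forall i j, antipode (u i j) = w i j.
Proof.
move=> uw i j.
have -> : antipode (u i j) = \sum_l antipode (u i l) * (l == j)%:R.
  rewrite (bigD1 j) //= eqxx mulr1 big1 ?addr0 // => l /negbTE ->.
  by rewrite mulr0.
under eq_bigr => l _ do rewrite -uw mulr_sumr.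
rewrite exchange_big /=.
under eq_bigr => k _.
  under eq_bigr => l _ do rewrite mulrA.
  rewrite -mulr_suml coalg_antipodel; over.
rewrite (bigD1 i) //= eqxx mul1r big1 ?addr0 // => l; rewrite eq_sym => /negbTE ->.
by rewrite mul0r.
Qed.
End MatrixCoalgebra.

Lemma corep_antipodel n (U : 'M[A]_n) :
  corepresentation U -> map_mx antipode U *m U = 1%:M.
Proof.
case=> cU eU; apply/matrixP => i j; rewrite !mxE -(coalg_antipodel cU eU).
by apply: eq_bigr => k _; rewrite mxE.
Qed.

Lemma corep_antipoder n (U : 'M[A]_n) :
  corepresentation U -> U *m map_mx antipode U = 1%:M.
Proof.
case=> cU eU; apply/matrixP => i j; rewrite !mxE -(coalg_antipoder cU eU).
by apply: eq_bigr => k _; rewrite mxE.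
Qed.

Lemma corep_antipode_uniq n (U W : 'M[A]_n) :
  corepresentation U -> U *m W = 1%:M -> map_mx antipode U = W.
Proof.
move=> cU UW; rewrite -[LHS]mulmx1 -UW mulmxA corep_antipodel //.
exact: mul1mx.
Qed.

(** The formula behind the computations below: both the antipode and the adjoint
    of U are inverse to U. *)
Lemma unitary_corep_antipode n (U : 'M[A]_n) : unitary_corep U ->
  forall i j, antipode (U i j) = star (U j i).
Proof.
case=> cU [_ UU] i j; have /matrixP/(_ i j) := corep_antipode_uniq cU UU.
by rewrite !mxE.
Qed.
End HopfMaps.

Section CQGBasics.
Variables (R : realType) (A : cqgType R).

(** The span of the unitary coefficients is everything, so an identity that is
    linear or antilinear in a is checked on such coefficients. *)
Lemma cqg_ind (P : A -> Prop) : P 0 ->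
  (forall a b, P a -> P b -> P (a + b)) ->
  (forall c a, P a -> P (c *: a)) ->
  (forall n (U : 'M[A]_n) i j, unitary_corep U -> P (U i j)) ->
  forall a, P a.
Proof.
move=> P0 PD PZ Pc a; have [s sP ->] := coefficient_span a.
elim: s sP => [|p s IH] sP; first by rewrite big_nil.
rewrite big_cons; apply: PD; last by apply: IH => q qs; apply: sP; rewrite inE qs orbT.
by have [|n [U [i [j [uU ->]]]]] := sP p; rewrite ?mem_head //; apply/PZ/Pc.
Qed.

Lemma star_antipode_star_antipode (a : A) :
  star (antipode (star (antipode a))) = a.
Proof.
elim/cqg_ind: a => [|a b Ha Hb|c a Ha|n U i j uU].
- by rewrite !raddf0.
- by rewrite !raddfD /= Ha Hb.
- rewrite linearZ /= starZ linearZ /= starZ Ha.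
  by rewrite conjcK.
- by rewrite (unitary_corep_antipode uU) starK (unitary_corep_antipode uU) starK.
Qed.

Lemma counit_star (a : A) : counit (star a) = (counit a)^*%C.
Proof.
elim/cqg_ind: a => [|a b Ha Hb|c a Ha|n U i j uU].
- by rewrite !raddf0.
- by rewrite !raddfD /= Ha Hb.
- by rewrite starZ !linearZ /= Ha rmorphM.
rewrite -(unitary_corep_antipode uU) -[RHS]mulr1.
have /(congr1 (@counit R A)) := coalg_antipodel uU.1.1 uU.1.2 j i.
rewrite raddf_sum /= rmorph_nat (bigD1 i) //= big1 => [|k ki].
  by rewrite rmorphM /= !uU.1.2 eqxx !mulr1 addr0 eq_sym => ->; rewrite conjc_nat.
by rewrite rmorphM /= uU.1.2 (negbTE ki) mulr0.
Qed.

Lemma counit_antipode (a : A) : counit (antipode a) = counit a.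
Proof.
elim/cqg_ind: a => [|a b Ha Hb|c a Ha|n U i j uU].
- by rewrite !raddf0.
- by rewrite !raddfD /= Ha Hb.
- by rewrite !linearZ /= Ha.
- by rewrite (unitary_corep_antipode uU) counit_star !uU.1.2 conjc_nat eq_sym.
Qed.

Lemma comul_antipode (a : A) :
  comul (antipode a) = tlift (fun x y => antipode y ⊗t antipode x) (comul a).
Proof.
have bS := @balanced_antipode_flip R A.
elim/cqg_ind: a => [|a b Ha Hb|c a Ha|n U i j uU].
- by rewrite !raddf0 tlift0.
- by rewrite !raddfD /= tliftD // Ha Hb.
- rewrite !linearZ /= Ha; elim/tensor_ind: (comul a) => [|x y|x y Hx Hy].
  + by rewrite scaler0 tlift0 // scaler0.
  + rewrite tpureZl !tlift_pure // linearZ /= tpureZl.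
    by have [_ _ ->] := @tpure_balanced _ A A.
  + by rewrite scalerDr !tliftD // scalerDr Hx Hy.
rewrite (unitary_corep_antipode uU) comul_star !uU.1.1 tlift_sum_pure //.
rewrite /tmap tlift_sum_pure; last exact: balanced_star.
by apply: eq_bigr => k _; rewrite !(unitary_corep_antipode uU).
Qed.

(** The matrix with entries S(v_kl) S(u_ij) is inverse to the tensor product
    corepresentation with entries u_ij v_kl. *)
Lemma antipodeM (a b : A) : antipode (a * b) = antipode b * antipode a.
Proof.
elim/cqg_ind: a => [|a a' Ha Ha'|c a Ha|n U i j uU].
- by rewrite !(mul0r, raddf0, mulr0).
- by rewrite mulrDl !raddfD /= Ha Ha' mulrDr.
- by rewrite -scalerAl !linearZ /= Ha scalerAr.
elim/cqg_ind: b => [|b b' Hb Hb'|c b Hb|m V k l uV].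
- by rewrite !(mul0r, raddf0, mulr0).
- by rewrite mulrDr !raddfD /= Hb Hb' mulrDl.
- by rewrite -scalerAr !linearZ /= Hb scalerAl.
pose u (p q : 'I_n * 'I_m) := U p.1 q.1 * V p.2 q.2.
pose w (p q : 'I_n * 'I_m) := antipode (V p.2 q.2) * antipode (U p.1 q.1).
apply: (@coalg_antipode_uniq _ _ _ u _ _ w _ (i, k) (j, l)) => [p q|p q|p q].
- rewrite rmorphM /= uU.1.1 uV.1.1 mulr_suml.
  rewrite -(pair_bigA _ (fun a b => u p (a, b) ⊗t u (a, b) q)) /=.
  apply: eq_bigr => a _; rewrite mulr_sumr; apply: eq_bigr => b _.
  exact: tmul_pure.
- rewrite rmorphM /= uU.1.2 uV.1.2 -natrM mulnb; congr (_%:R); congr (nat_of_bool _).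
- rewrite -(pair_bigA _ (fun a b =>
    U p.1 a * V p.2 b * (antipode (V b q.2) * antipode (U a q.1)))) /=.
  under eq_bigr => a _.
    under eq_bigr => b _ do rewrite -mulrA (mulrA (V _ _)).
    rewrite -mulr_sumr -mulr_suml (coalg_antipoder uV.1.1 uV.1.2); over.
  have [e|ne] := eqVneq p.2 q.2; last first.
    rewrite big1 => [|a _]; last by rewrite mul0r mulr0.
    by rewrite -pair_eqE /= /pair_eq (negbTE ne) andbF.
  under eq_bigr => a _ do rewrite mul1r.
  rewrite (coalg_antipoder uU.1.1 uU.1.2).
  by rewrite -[in RHS]pair_eqE /= /pair_eq e eqxx andbT.
Qed.
End CQGBasics.

(** * Ideals and the Kac ideal *)

Section Ideals.
Variables (R : realType) (A : hopfStarType R).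

Lemma ideal_genP (X : set A) : two_sided_ideal (ideal_gen X).
Proof.
split=> [I [[]]//|a b Xa Xb I XI|a b Xb I XI|a b Xa I XI]; have [[I0 ID Il Ir] _] := XI.
- by apply: ID; [apply: Xa|apply: Xb].
- by apply: Il; apply: Xb.
- by apply: Ir; apply: Xa.
Qed.

Lemma ideal_gen_sub (X I : set A) :
  two_sided_ideal I -> X `<=` I -> ideal_gen X `<=` I.
Proof. exact: smallest_sub. Qed.

Lemma sub_ideal_gen (X : set A) : X `<=` ideal_gen X.
Proof. exact: sub_gen_smallest. Qed.

Section OneIdeal.
Variable I : set A.
Hypothesis idealI : two_sided_ideal I.

Lemma ideal_scale c a : I a -> I (c *: a).
Proof. by case: idealI => _ _ Il _ Ia; rewrite -mulr_algl; apply: Il. Qed.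

Lemma ideal_opp a : I a -> I (- a).
Proof. by rewrite -scaleN1r; apply: ideal_scale. Qed.

Lemma ideal_tensor0 : ideal_tensor I 0.
Proof. by exists [::]; rewrite ?big_nil. Qed.

Lemma ideal_tensorD x y : ideal_tensor I x -> ideal_tensor I y -> ideal_tensor I (x + y).
Proof.
move=> [s sI ->] [t tI ->]; exists (s ++ t); last by rewrite big_cat.
by move=> p; rewrite mem_cat => /orP[/sI|/tI].
Qed.

Lemma ideal_tensor_pure a b : I a \/ I b -> ideal_tensor I (a ⊗t b).
Proof.
by move=> h; exists [:: (a, b)]; rewrite ?big_seq1// => p; rewrite inE => /eqP ->.
Qed.

Lemma ideal_tensor_ind (P : A ⊗ A -> Prop) : P 0 ->
  (forall x y, P x -> P y -> P (x + y)) ->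
  (forall a b, I a \/ I b -> P (a ⊗t b)) ->
  forall x, ideal_tensor I x -> P x.
Proof.
move=> P0 PD Pp x [s sI ->]; rewrite big_seq.
by elim/big_ind: _ => // p /sI; apply: Pp.
Qed.

Lemma ideal_tensor_mull x y : ideal_tensor I y -> ideal_tensor I (x * y).
Proof.
case: idealI => _ _ Il _.
move: y; apply: ideal_tensor_ind => [|y y' Hy Hy'|a b Iab].
- by rewrite mulr0; apply: ideal_tensor0.
- by rewrite mulrDr; apply: ideal_tensorD.
elim/tensor_ind: x => [|c d|x x' Hx Hx'].
- by rewrite mul0r; apply: ideal_tensor0.
- rewrite [_ * _]tmul_pure; apply: ideal_tensor_pure.
  by case: Iab => h; [left|right]; apply: Il.
- by rewrite mulrDl; apply: ideal_tensorD.
Qed.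

Lemma ideal_tensor_mulr x y : ideal_tensor I x -> ideal_tensor I (x * y).
Proof.
case: idealI => _ _ _ Ir.
move: x; apply: ideal_tensor_ind => [|x x' Hx Hx'|a b Iab].
- by rewrite mul0r; apply: ideal_tensor0.
- by rewrite mulrDl; apply: ideal_tensorD.
elim/tensor_ind: y => [|c d|y y' Hy Hy'].
- by rewrite mulr0; apply: ideal_tensor0.
- rewrite [_ * _]tmul_pure; apply: ideal_tensor_pure.
  by case: Iab => h; [left|right]; apply: Ir.
- by rewrite mulrDr; apply: ideal_tensorD.
Qed.

Lemma comul_preimage_ideal : two_sided_ideal [set a | ideal_tensor I (comul a)].
Proof.
split=> /= [|a b Ia Ib|a b Ib|a b Ia].
- by rewrite raddf0; apply: ideal_tensor0.
- by rewrite raddfD; apply: ideal_tensorD.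
- by rewrite rmorphM; apply: ideal_tensor_mull.
- by rewrite rmorphM; apply: ideal_tensor_mulr.
Qed.

End OneIdeal.
End Ideals.

(** The telescoping that makes the image under comul of a difference
    fall in I ⊗ A + A ⊗ I. *)
Lemma tpureBB (K : comNzRingType) (U V : lmodType K) (u u' : U) (v v' : V) :
  u ⊗t v - u' ⊗t v' = (u - u') ⊗t v + u' ⊗t (v - v').
Proof.
have [tDl tDr _] := @tpure_balanced K U V; apply: (addIr (u' ⊗t v')).
by rewrite subrK -addrA -tDr subrK -tDl subrK.
Qed.

Section KacIdeal.
Variables (R : realType) (A : cqgType R).
Local Notation S2 := (antipode \o antipode).
Local Notation Kac := (kac_ideal A).

Lemma kac_idealP : two_sided_ideal Kac.
Proof. exact: ideal_genP. Qed.

Lemma kac_ideal_gen (a : A) : Kac (antipode (antipode a) - a).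
Proof. by apply: sub_ideal_gen; exists a. Qed.

Lemma comul_antipode2 (a : A) :
  comul (antipode (antipode a)) = tmap S2 S2 (comul a).
Proof.
have bS := @balanced_antipode_flip R A.
rewrite comul_antipode comul_antipode.
elim/tensor_ind: (comul a) => [|x y|x y Hx Hy].
- by rewrite tmap0 !tlift0.
- by rewrite tmap_pure !tlift_pure.
- by rewrite tmapD !tliftD // Hx Hy.
Qed.

(** On the generators, the coproduct of S^2 a - a is the difference of S^2 ⊗ S^2
    and the identity, applied to the coproduct of a. *)
Lemma kac_ideal_comul (a : A) : Kac a -> ideal_tensor Kac (comul a).
Proof.
move: a; apply: ideal_gen_sub; first exact/comul_preimage_ideal/kac_idealP.
move=> _ [a _ <-] /=; rewrite raddfB /= comul_antipode2.
elim/tensor_ind: (comul a) => [|u v|x y Hx Hy].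
- by rewrite tmap0 subr0; apply: ideal_tensor0.
- rewrite tmap_pure tpureBB.
  by apply: ideal_tensorD; apply: ideal_tensor_pure; [left|right]; apply: kac_ideal_gen.
- by rewrite tmapD opprD addrACA; apply: ideal_tensorD.
Qed.

Lemma kac_hopf_star_ideal : hopf_star_ideal Kac.
Proof.
have [K0 KD Kl Kr] := kac_idealP.
split; [exact: kac_idealP|exact: kac_ideal_comul|..].
- apply: (@ideal_gen_sub _ _ _ [set a | counit a = 0]) => [|_ [a _ <-] /=].
    split=> /= [|a b|a b|a b]; first exact: raddf0.
    + by rewrite raddfD /= => -> ->; rewrite addr0.
    + by rewrite rmorphM /= => ->; rewrite mulr0.
    + by rewrite rmorphM /= => ->; rewrite mul0r.
  by rewrite raddfB /= !counit_antipode subrr.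
- apply: (@ideal_gen_sub _ _ _ [set a | Kac (antipode a)]) => [|_ [a _ <-] /=].
    split=> /= [|a b Ka Kb|a b Kb|a b Ka]; first by rewrite raddf0.
    + by rewrite raddfD; apply: KD.
    + by rewrite antipodeM; apply: Kr.
    + by rewrite antipodeM; apply: Kl.
  by rewrite raddfB; apply: kac_ideal_gen.
- apply: (@ideal_gen_sub _ _ _ [set a | Kac (star a)]) => [|_ [a _ <-] /=].
    split=> /= [|a b Ka Kb|a b Kb|a b Ka]; first by rewrite raddf0.
    + by rewrite raddfD; apply: KD.
    + by rewrite starM; apply: Kr.
    + by rewrite starM; apply: Kl.
  (* star maps a generator to the opposite of the generator attached to
     b = star (S^2 a), because S^2 b = star a. *)
  have aK (b : A) : antipode (star (antipode b)) = star b.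
    by apply: (can_inj (@starK R A)); rewrite star_antipode_star_antipode starK.
  have -> : star (antipode (antipode a) - a) =
      - (antipode (antipode (star (antipode (antipode a)))) - star (antipode (antipode a))).
    by rewrite !aK opprB raddfB.
  by apply: (ideal_opp kac_idealP); apply: kac_ideal_gen.
Qed.
End KacIdeal.

(** * Quotient by a Hopf *-ideal *)

Section QuotientHopf.
Local Open Scope quotient_scope.
Variables (R : realType) (A : hopfStarType R) (I : set A).
Hypothesis hI : hopf_star_ideal I.

Let idI : two_sided_ideal I. Proof. by case: hI. Qed.

Definition ideal_rel (a b : A) : bool := `[< I (a - b) >].

Lemma ideal_rel_refl : reflexive ideal_rel.
Proof. by move=> a; apply/asboolP; rewrite subrr; case: idI. Qed.

Lemma ideal_rel_sym : symmetric ideal_rel.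
Proof.
by move=> a b; apply/asboolP/asboolP => /(ideal_opp idI); rewrite opprB.
Qed.

Lemma ideal_rel_trans : transitive ideal_rel.
Proof.
move=> b a c /asboolP ab /asboolP bc; apply/asboolP.
by case: idI => _ ID _ _; rewrite -(subrK b a) -addrA; apply: ID.
Qed.

Canonical ideal_equiv :=
  EquivRel ideal_rel ideal_rel_refl ideal_rel_sym ideal_rel_trans.

Definition hquot := {eq_quot ideal_equiv}.
HB.instance Definition _ := Choice.on hquot.
HB.instance Definition _ := EqQuotient.on hquot.

Definition hproj (a : A) : hquot := \pi_hquot a.

Lemma hproj_eq a b : hproj a = hproj b <-> I (a - b).
Proof.
rewrite /hproj; split=> [/eqmodP/asboolP //|ab].
by apply/eqmodP/asboolP.
Qed.

Lemma hproj_surj (x : hquot) : exists a, hproj a = x.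
Proof. by exists (repr x); rewrite /hproj reprK. Qed.

Lemma hquotW (P : hquot -> Prop) : (forall a, P (hproj a)) -> forall x, P x.
Proof. by move=> PP x; have [a <-] := hproj_surj x. Qed.

Lemma hreprP a : I (repr (hproj a) - a).
Proof. by apply/hproj_eq; rewrite /hproj reprK. Qed.

Definition qadd (x y : hquot) : hquot := hproj (repr x + repr y).
Definition qopp (x : hquot) : hquot := hproj (- repr x).
Definition qmul (x y : hquot) : hquot := hproj (repr x * repr y).
Definition qscale (c : R[i]) (x : hquot) : hquot := hproj (c *: repr x).
Definition qstar (x : hquot) : hquot := hproj (star (repr x)).
Definition qantipode (x : hquot) : hquot := hproj (antipode (repr x)).
Definition qcounit (x : hquot) : R[i] := counit (repr x).

Lemma qaddE a b : qadd (hproj a) (hproj b) = hproj (a + b).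
Proof.
apply/hproj_eq; rewrite opprD addrACA.
by case: idI => _ ID _ _; apply: ID; apply: hreprP.
Qed.

Lemma qoppE a : qopp (hproj a) = hproj (- a).
Proof. by apply/hproj_eq; rewrite -opprD; apply/(ideal_opp idI)/hreprP. Qed.

Lemma qmulE a b : qmul (hproj a) (hproj b) = hproj (a * b).
Proof.
apply/hproj_eq; case: idI => _ ID Il Ir.
have -> : repr (hproj a) * repr (hproj b) - a * b =
  (repr (hproj a) - a) * repr (hproj b) + a * (repr (hproj b) - b).
  by rewrite mulrBl mulrBr addrA subrK.
by apply: ID; [apply: Ir|apply: Il]; apply: hreprP.
Qed.

Lemma qscaleE c a : qscale c (hproj a) = hproj (c *: a).
Proof. by apply/hproj_eq; rewrite -scalerBr; apply/(ideal_scale idI)/hreprP. Qed.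

Lemma qstarE a : qstar (hproj a) = hproj (star a).
Proof.
by apply/hproj_eq; rewrite -raddfB; case: hI => _ _ _ _; apply; apply: hreprP.
Qed.

Lemma qantipodeE a : qantipode (hproj a) = hproj (antipode a).
Proof.
by apply/hproj_eq; rewrite -raddfB; case: hI => _ _ _ + _; apply; apply: hreprP.
Qed.

Lemma qcounitE a : qcounit (hproj a) = counit a.
Proof.
apply/eqP; rewrite -subr_eq0 -raddfB; apply/eqP.
by case: hI => _ _ + _ _; apply; apply: hreprP.
Qed.

Fact qaddA : associative qadd.
Proof. by do 3![elim/hquotW=> ?]; rewrite !qaddE addrA. Qed.
Fact qaddC : commutative qadd.
Proof. by do 2![elim/hquotW=> ?]; rewrite !qaddE addrC. Qed.
Fact qadd0 : left_id (hproj 0) qadd.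
Proof. by elim/hquotW=> ?; rewrite qaddE add0r. Qed.
Fact qaddN : left_inverse (hproj 0) qopp qadd.
Proof. by elim/hquotW=> ?; rewrite qoppE qaddE addNr. Qed.

HB.instance Definition _ := GRing.isZmodule.Build hquot qaddA qaddC qadd0 qaddN.

Fact qmulA : associative qmul.
Proof. by do 3![elim/hquotW=> ?]; rewrite !qmulE mulrA. Qed.
Fact qmul1x : left_id (hproj 1) qmul.
Proof. by elim/hquotW=> ?; rewrite qmulE mul1r. Qed.
Fact qmulx1 : right_id (hproj 1) qmul.
Proof. by elim/hquotW=> ?; rewrite qmulE mulr1. Qed.
Fact qmulDl : left_distributive qmul +%R.
Proof.
elim/hquotW=> a; elim/hquotW=> b; elim/hquotW=> c.
by rewrite [_ + _]qaddE !qmulE [RHS]qaddE mulrDl.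
Qed.
Fact qmulDr : right_distributive qmul +%R.
Proof.
elim/hquotW=> a; elim/hquotW=> b; elim/hquotW=> c.
by rewrite [_ + _]qaddE !qmulE [RHS]qaddE mulrDr.
Qed.
(* The counit vanishes on I but not at 1. *)
Fact qone_neq0 : hproj 1 != 0.
Proof.
apply/eqP => /(congr1 qcounit).
by rewrite [0]/(hproj 0) !qcounitE rmorph1 raddf0 => /eqP; rewrite oner_eq0.
Qed.

HB.instance Definition _ := GRing.Zmodule_isNzRing.Build hquot
  qmulA qmul1x qmulx1 qmulDl qmulDr qone_neq0.

Fact qscaleA a b x : qscale a (qscale b x) = qscale (a * b) x.
Proof. by elim/hquotW: x => ?; rewrite !qscaleE scalerA. Qed.
Fact qscale1 : left_id 1 qscale.
Proof. by elim/hquotW=> ?; rewrite qscaleE scale1r. Qed.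
Fact qscaleDr : right_distributive qscale +%R.
Proof.
move=> c; elim/hquotW=> a; elim/hquotW=> b.
by rewrite [_ + _]qaddE !qscaleE [RHS]qaddE scalerDr.
Qed.
Fact qscaleDl x : {morph qscale^~ x : a b / a + b}.
Proof.
by elim/hquotW: x => x a b; rewrite !qscaleE [RHS]qaddE scalerDl.
Qed.
HB.instance Definition _ := GRing.Zmodule_isLmodule.Build R[i] hquot
  qscaleA qscale1 qscaleDr qscaleDl.

Lemma hprojM a b : hproj (a * b) = hproj a * hproj b.
Proof. exact/esym/qmulE. Qed.
Lemma hprojZ c a : hproj (c *: a) = c *: hproj a.
Proof. exact/esym/qscaleE. Qed.

Fact qscaleAl (c : R[i]) (x y : hquot) : c *: (x * y) = c *: x * y.
Proof.
elim/hquotW: x => a; elim/hquotW: y => b.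
by rewrite -hprojM -!hprojZ -hprojM scalerAl.
Qed.
HB.instance Definition _ := GRing.Lmodule_isLalgebra.Build R[i] hquot qscaleAl.
Fact qscaleAr (c : R[i]) (x y : hquot) : c *: (x * y) = x * (c *: y).
Proof.
elim/hquotW: x => a; elim/hquotW: y => b.
by rewrite -hprojM -!hprojZ -hprojM scalerAr.
Qed.
HB.instance Definition _ := GRing.Lalgebra_isAlgebra.Build R[i] hquot qscaleAr.

Fact hproj_linear : linear hproj.
Proof. by move=> c a b; rewrite -hprojZ [RHS]qaddE. Qed.
HB.instance Definition _ := GRing.isLinear.Build R[i] A hquot *:%R hproj hproj_linear.
Fact hproj_monoid : monoid_morphism hproj.
Proof. by split=> // a b; rewrite hprojM. Qed.
HB.instance Definition _ := GRing.isMonoidMorphism.Build A hquot hproj hproj_monoid.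

(** The map hproj ⊗ hproj kills I ⊗ A + A ⊗ I, which is where comul sends I: the
    value below does not depend on the representative. *)
Definition qcomul (x : hquot) : hquot ⊗ hquot := tmap hproj hproj (comul (repr x)).

Lemma hproj_eq0 a : hproj a = 0 <-> I a.
Proof. by rewrite -[in I a](subr0 a) -hproj_eq. Qed.

Lemma tmap_hproj_eq0 x : ideal_tensor I x -> tmap hproj hproj x = 0.
Proof.
move: x; apply: ideal_tensor_ind => [|x y Hx Hy|a b Iab]; first exact: tmap0.
  by rewrite tmapD Hx Hy addr0.
rewrite tmap_pure /=; case: Iab => /hproj_eq0 ->.
  exact: tpure0l.
exact: tpure0r.
Qed.

Lemma qcomulE a : qcomul (hproj a) = tmap hproj hproj (comul a).
Proof.
have [_ IC _ _ _] := hI.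
apply/eqP; rewrite -subr_eq0; apply/eqP.
rewrite /qcomul -(tmap_hproj_eq0 (IC _ (hreprP a))) raddfB.
rewrite tmapD; congr (_ + _).
by rewrite -scaleN1r -[in RHS]scaleN1r tmapZ.
Qed.

Fact qcomul_linear : linear qcomul.
Proof.
move=> c; elim/hquotW=> a; elim/hquotW=> b.
by rewrite -linearP !qcomulE linearP tmapD tmapZ.
Qed.
HB.instance Definition _ := GRing.isLinear.Build R[i] hquot (hquot ⊗ hquot) *:%R
  qcomul qcomul_linear.

Fact qstarK : involutive qstar.
Proof. by elim/hquotW=> a; rewrite !qstarE starK. Qed.
Fact qstarD : {morph qstar : a b / a + b}.
Proof.
by elim/hquotW=> a; elim/hquotW=> b; rewrite -raddfD !qstarE starD raddfD.
Qed.
Fact qstarZ (c : R[i]) a : qstar (c *: a) = (c^*)%C *: qstar a.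
Proof. by elim/hquotW: a => a; rewrite -linearZ !qstarE starZ linearZ. Qed.
Fact qstarM a b : qstar (a * b) = qstar b * qstar a.
Proof.
by elim/hquotW: a => a; elim/hquotW: b => b; rewrite -rmorphM !qstarE starM rmorphM.
Qed.
Fact qcomul_monoid : monoid_morphism qcomul.
Proof.
split; first by rewrite -(rmorph1 hproj) qcomulE rmorph1 [1 in LHS]/(1 ⊗t 1) tmap_pure rmorph1.
by elim/hquotW=> a; elim/hquotW=> b; rewrite -rmorphM !qcomulE rmorphM tmapM.
Qed.
Fact qcounit_linear : scalar qcounit.
Proof.
by move=> c; elim/hquotW=> a; elim/hquotW=> b; rewrite -linearP !qcounitE linearP.
Qed.
Fact qcounit_monoid : monoid_morphism qcounit.
Proof.
split; first by rewrite -(rmorph1 hproj) qcounitE rmorph1.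
by elim/hquotW=> a; elim/hquotW=> b; rewrite -rmorphM !qcounitE rmorphM.
Qed.
Fact qantipode_linear : linear qantipode.
Proof.
by move=> c; elim/hquotW=> a; elim/hquotW=> b; rewrite -linearP !qantipodeE !linearP.
Qed.
HB.instance Definition _ := GRing.isLinear.Build R[i] hquot R[i] *%R
  qcounit qcounit_linear.
HB.instance Definition _ := GRing.isLinear.Build R[i] hquot hquot *:%R
  qantipode qantipode_linear.

Lemma qantipodeZ c (x : hquot) : qantipode (c *: x) = c *: qantipode x.
Proof. exact: linearZ. Qed.

Fact qcomulA a : tassoc (tmap qcomul id (qcomul a)) = tmap id qcomul (qcomul a).
Proof.
elim/hquotW: a => a; rewrite qcomulE.
rewrite (@eq_tmap_comp _ _ _ _ _ _ _ _ _ qcomul idfun hproj hproj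
  (tmap hproj hproj) hproj comul idfun) => [|u|//]; last exact: qcomulE.
rewrite tassoc_tmap comulA.
apply: (@eq_tmap_comp _ _ _ _ _ _ _ _ _ hproj (tmap hproj hproj) idfun comul
  idfun qcomul hproj hproj) => // u; exact/esym/qcomulE.
Qed.

Lemma balanced_scale (B : lalgType R[i]) (e : {scalar B}) :
  balanced (fun x y : B => e x *: y) /\ balanced (fun x y : B => e y *: x).
Proof.
by split; split=> *; rewrite ?raddfD ?linearZ /= ?(scalerDl, scalerDr) //
  scalerA mulrC.
Qed.

Fact qcounitl a : tlift (fun x y => qcounit x *: y) (qcomul a) = a.
Proof.
elim/hquotW: a => a; rewrite qcomulE.
rewrite (@tlift_tmap _ _ _ _ _ _ _ _ _ (fun x y : A => counit x *: y) _ hproj).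
- by rewrite counitl.
- by case: (balanced_scale (@counit R A)).
- by case: (balanced_scale qcounit).
- by move=> u v; rewrite /= qcounitE linearZ.
Qed.

Fact qcounitr a : tlift (fun x y => qcounit y *: x) (qcomul a) = a.
Proof.
elim/hquotW: a => a; rewrite qcomulE.
rewrite (@tlift_tmap _ _ _ _ _ _ _ _ _ (fun x y : A => counit y *: x) _ hproj).
- by rewrite counitr.
- by case: (balanced_scale (@counit R A)).
- by case: (balanced_scale qcounit).
- by move=> u v; rewrite /= qcounitE linearZ.
Qed.

Fact qantipodel a :
  tlift (fun x y => qantipode x * y) (qcomul a) = qcounit a *: 1.
Proof.
elim/hquotW: a => a; rewrite qcomulE qcounitE.
rewrite (@tlift_tmap _ _ _ _ _ _ _ _ _ (fun x y : A => antipode x * y) _ hproj).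
- by rewrite antipodel /= hprojZ.
- exact: balanced_antipodel.
- split=> [u u' v|u v v'|c u v]; first by rewrite ?raddfD ?mulrDl ?mulrDr.
    by rewrite ?raddfD ?mulrDl ?mulrDr.
  by rewrite qantipodeZ -scalerAl scalerAr.
- by move=> u v; rewrite /= qantipodeE rmorphM.
Qed.

Fact qantipoder a :
  tlift (fun x y => x * qantipode y) (qcomul a) = qcounit a *: 1.
Proof.
elim/hquotW: a => a; rewrite qcomulE qcounitE.
rewrite (@tlift_tmap _ _ _ _ _ _ _ _ _ (fun x y : A => x * antipode y) _ hproj).
- by rewrite antipoder /= hprojZ.
- exact: balanced_antipoder.
- split=> [u u' v|u v v'|c u v]; first by rewrite ?raddfD ?mulrDl ?mulrDr.
    by rewrite ?raddfD ?mulrDl ?mulrDr.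
  by rewrite qantipodeZ -scalerAr scalerAl.
- by move=> u v; rewrite /= qantipodeE rmorphM.
Qed.

Fact qcomul_star a : qcomul (qstar a) = tmap qstar qstar (qcomul a).
Proof.
elim/hquotW: a => a; rewrite qstarE !qcomulE comul_star.
rewrite [RHS](@tlift_tmap _ _ _ _ _ _ _ _ _ (fun x y : A => star x ⊗t star y)
  _ (tmap hproj hproj)) //.
- exact: balanced_star.
- have [tDl tDr tZ] := @tpure_balanced _ hquot hquot.
  by split=> *; rewrite ?qstarD ?qstarZ ?tDl ?tDr ?tZ.
- by move=> u v; rewrite /= !qstarE tmap_pure.
Qed.

HB.instance Definition _ := isHopfStar.Build R hquot qstarK qstarD qstarZ qstarM
  qcomul_linear qcomul_monoid qcounit_linear qcounit_monoid qantipode_linear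
  qcomulA qcounitl qcounitr qantipodel qantipoder qcomul_star.

Lemma hproj_hopf : hopf_star_morphism (hproj : {lrmorphism A -> hquot}).
Proof.
split=> a; [exact/esym/qstarE|exact: qcomulE|exact: qcounitE|].
exact/esym/qantipodeE.
Qed.
End QuotientHopf.

Section HopfImage.
Variables (R : realType) (A B : hopfStarType R) (f : {lrmorphism A -> B}).
Hypothesis hf : hopf_star_morphism f.

(** Hence the coefficients of the quotient are spanned by images of unitary
    coefficients, which makes the quotient a CQG-algebra. *)
Lemma hopf_morphism_unitary_corep n (U : 'M[A]_n) :
  unitary_corep U -> unitary_corep (map_mx f U).
Proof.
have [fs fc fe _] := hf.
case=> [[cU eU] [sU Us]].
have starE : starmx (map_mx f U) = map_mx f (starmx U).
  by apply/matrixP => i j; rewrite !mxE fs.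
split; split.
- move=> i j; rewrite mxE fc cU /tmap tlift_sum_pure; last exact: balanced_pure.
  by apply: eq_bigr => k _; rewrite !mxE.
- by move=> i j; rewrite mxE fe.
- by rewrite starE -map_mxM sU map_mx1.
- by rewrite starE -map_mxM Us map_mx1.
Qed.
End HopfImage.

Section QuotientCQG.
Variables (R : realType) (A : cqgType R) (I : set A).
Hypothesis hI : hopf_star_ideal I.

Fact hquot_coefficient_span (a : hquot hI) : exists2 s : seq (R[i] * hquot hI),
  (forall p, p \in s -> coefficient p.2) & a = \sum_(p <- s) p.1 *: p.2.
Proof.
elim/hquotW: a => a; have [s sP ->] := coefficient_span a.
exists [seq (p.1, hproj hI p.2) | p <- s]; last first.
  by rewrite big_map raddf_sum; apply: eq_bigr => p _; rewrite /= hprojZ.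
move=> _ /mapP[p /sP [n [U [i [j [uU ->]]]]] ->].
exists n, (map_mx (hproj hI) U), i, j; rewrite mxE; split=> //.
exact/hopf_morphism_unitary_corep/uU/hproj_hopf.
Qed.
HB.instance Definition _ := isCQG.Build R (hquot hI) hquot_coefficient_span.
End QuotientCQG.

Section MaximalKac.
Variables (R : realType) (A : cqgType R).

Lemma kac_maximal : exists (K : cqgType R) (pi : {lrmorphism A -> K}),
  maximal_kac pi /\ mker pi = kac_ideal A.
Proof.
pose hK := kac_hopf_star_ideal A.
exists (hquot hK), (hproj hK : {lrmorphism A -> hquot hK}).
have kerE : mker (hproj hK : {lrmorphism A -> hquot hK}) = kac_ideal A.
  by apply/seteqP; split=> a Ka; apply/(hproj_eq0 hK).
split=> //; split.
- by split; [exact: hproj_hopf|exact: hproj_surj].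
- elim/hquotW=> a; have [_ _ _ hS] := hproj_hopf hK; rewrite -(hS a) -(hS (antipode a)).
  apply/(hproj_eq hK). exact: kac_ideal_gen.
move=> H g [[_ _ _ gS] _] kacH; rewrite kerE.
apply: ideal_gen_sub => [|_ [a _ <-]]; last first.
  by rewrite /mker /= raddfB /= !gS kacH subrr.
split=> [|a b|a b|a b]; rewrite /mker /= ?raddf0 //.
- by move=> ga gb; rewrite raddfD /= ga gb addr0.
- by move=> gb; rewrite rmorphM /= gb mulr0.
- by move=> ga; rewrite rmorphM /= ga mul0r.
Qed.
End MaximalKac.

(** * Linear forms and Parseval families *)

Local Notation "M ^†" := (map_mx Num.conj M^T) (at level 8, format "M ^†").

Lemma conjCE (R : realType) (x : R[i]) : Num.conj x = conjc x.
Proof. by []. Qed.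

Section SeparatingForms.
Variables (K : fieldType) (V : lmodType K).

Definition subspace (W : set V) : Prop :=
  [/\ W 0, forall x y, W x -> W y -> W (x + y)
    & forall c x, W x -> W (c *: x)].

(** Linear forms separate the points of any vector space. A subspace W maximal
    among those avoiding a is a hyperplane complementing the line of a, and the
    coordinate along a is the form sought. *)
Lemma scalar_forms_separate (a : V) :
  (forall f : V -> K, scalar f -> f a = 0) -> a = 0.
Proof.
apply: contraPP => a0; apply/existsNP.
(* The empty set is admitted so that the union of an empty chain is too. *)
pose P (W : set V) := W = set0 \/ (subspace W /\ ~ W a).
have [F FP totF|W [PW Wmax]] := @Zorn_bigcup V P.
  have [[W [FW W0]]|noW] := pselect (exists W, F W /\ W !=set0); last first.
    left; apply/seteqP; split=> // x [W FW Wx].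
    by apply: noW; exists W; split=> //; exists x.
  have sub X : F X -> X !=set0 -> subspace X /\ ~ X a.
    by move=> /FP [-> [x []]|].
  right; split; last first.
    move=> [X FX Xa]; have X0 : X !=set0 by exists a.
    by case: (sub X FX X0).
  split.
  - by exists W => //; case: (sub W FW W0) => [[]].
  - move=> x y [X FX Xx] [Y FY Yy].
    have [XY|YX] := totF X Y FX FY.
      have [|[_ YD _] _] := sub Y FY; first by exists y.
      by exists Y => //; apply: YD => //; apply: XY.
    have [|[_ XD _] _] := sub X FX; first by exists x.
    by exists X => //; apply: XD => //; apply: YX.
  - move=> c x [X FX Xx]; have [|[_ _ XZ] _] := sub X FX; first by exists x.
    by exists X => //; apply: XZ.
have [WS Wa] : subspace W /\ ~ W a.
  case: PW => // W0; exfalso; apply: (Wmax [set 0]).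
    by rewrite W0; split=> [x []|/(_ 0)]; apply.
  right; split; last by move=> /= aE; apply: a0.
  by split=> /= [//|x y -> ->|c x ->]; rewrite ?addr0 ?scaler0.
have [Z0 WD WZ] := WS.
have WB x y : W x -> W y -> W (x - y).
  by move=> Wx Wy; apply: WD => //; rewrite -scaleN1r; apply: WZ.
have dec x : exists c, W (x - c *: a).
  apply: contrapT => nx; pose W' := [set w + c *: x | w in W & c in [set: K]].
  have WW' : W `<=` W' by move=> w Ww; exists w => //; exists 0 => //; rewrite scale0r addr0.
  apply: (Wmax W').
    split=> // W'W; apply: nx; exists 0; rewrite scale0r subr0; apply: W'W.
    by exists 0 => //; exists 1 => //; rewrite scale1r add0r.
  right; split; last first.
    move=> [w Ww [c _ wca]]; have [c0|c0] := eqVneq c 0.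
      by apply: Wa; rewrite -wca c0 scale0r addr0.
    apply: nx; exists c^-1; rewrite -wca scalerDr scalerA mulVf // scale1r.
    by rewrite opprD addrCA subrr addr0 -scaleN1r; apply/WZ/WZ.
  split; first exact: WW'.
  - move=> _ _ [w Ww [c _ <-]] [w' Ww' [c' _ <-]].
    exists (w + w'); first exact: WD.
    by exists (c + c') => //; rewrite scalerDl addrACA.
  - move=> d _ [w Ww [c _ <-]]; exists (d *: w); first exact: WZ.
    by exists (d * c) => //; rewrite scalerDr scalerA.
have /choice[f fP] := dec.
have funi x c : W (x - c *: a) -> f x = c.
  move=> xc; apply/eqP; rewrite -subr_eq0; apply: contra_notT Wa => fc.
  rewrite -(scale1r a) -(mulVf fc) -scalerA; apply: WZ.
  rewrite scalerBl; suff -> : f x *: a - c *: a = x - c *: a - (x - f x *: a).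
    exact: WB.
  by rewrite opprB [RHS]addrC addrA subrK.
exists f => fs; have : f a = 1 by apply: funi; rewrite scale1r subrr.
rewrite fs => [/esym/eqP|c x y]; first by rewrite oner_eq0.
apply: funi; rewrite scalerDl -scalerA opprD addrACA -scalerBr.
by apply: WD => //; apply: WZ.
Qed.
End SeparatingForms.

Section Parseval.
Variable C : numClosedFieldType.

(** A subspace of row vectors, given as a predicate, is the row space of a matrix
    of maximal rank among those whose row space it contains. *)
Lemma subspace_row_space n (P : set 'rV[C]_n) : subspace P ->
  exists B : 'M[C]_n, forall v, P v <-> (v <= B)%MS.
Proof.
move=> [P0 PD PZ].
pose good (r : nat) := `[< exists2 B : 'M[C]_n, \rank B = r &
  forall v : 'rV_n, (v <= B)%MS -> P v >].
have ex0 : exists r, good r.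
  exists 0%N; apply/asboolP; exists 0; first exact: mxrank0.
  by move=> v; rewrite submx0 => /eqP ->.
have bnd r : good r -> (r <= n)%N by move=> /asboolP[B <- _]; apply: rank_leq_row.
case: (ex_maxnP ex0 bnd) => r /asboolP[B rB BP] rmax.
exists B => v; split=> [Pv|]; last exact: BP.
apply: contraT => vB.
have : (\rank (B + v)%MS <= r)%N.
  apply: rmax; apply/asboolP; exists (B + v)%MS => // u /sub_addsmxP[[x y] /= ->].
  apply: PD; first by apply: BP; apply: submxMl.
  by rewrite [y]mx11_scalar mul_scalar_mx; apply: PZ.
rewrite leqNgt -rB => /negP[]; apply: rank_ltmx.
by rewrite ltmxE addsmxSl /= addsmx_sub submx_refl.
Qed.


Lemma parseval_rows n (P : set 'rV[C]_n) : subspace P ->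
  exists d (E : 'M[C]_(d, n)), (forall i, P (row i E)) /\
    forall v, P v -> v *m E^† *m E = v.
Proof.
move=> /subspace_row_space[B BP]; exists (\rank B), (schmidt (row_base B)).
have EB : (schmidt (row_base B) :=: B)%MS.
  exact/(eqmx_trans (eqmx_schmidt_free (row_base_free B)))/eq_row_base.
split=> [i|v /BP]; first by apply/BP; rewrite -EB row_sub.
rewrite -EB => /submxP[D ->]; congr (_ *m _); apply: mulmxtVK.
by apply: schmidt_unitarymx; apply: rank_leq_col.
Qed.

(** The family a is an orthonormal basis of P for the inner product tr (x^† y),
    and the formula is the expansion of x in it. *)
Lemma parseval_matrices n (P : set 'M[C]_n) : subspace P ->
  exists d (a : 'I_d -> 'M[C]_n), (forall i, P (a i)) /\
    forall x, P x -> x = \sum_i \tr ((a i)^† *m x) *: a i.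
Proof.
move=> [P0 PD PZ]; pose P' (v : 'rV[C]_(n * n)) := P (vec_mx v).
have sP' : subspace P'.
  split=> [|v w|c v]; rewrite /P' ?linear0 ?linearD ?linearZ //=; first exact: PD.
  exact: PZ.
have [d [E [PE Ev]]] := parseval_rows sP'.
exists d, (fun i => vec_mx (row i E)); split=> // x Px.
rewrite -[LHS]mxvecK -(Ev (mxvec x)); last by rewrite /P' mxvecK.
rewrite mulmx_sum_row linear_sum; apply: eq_bigr => i _.
rewrite linearZ; congr (_ *: _).
rewrite -[in RHS](mxvecK x) mxtrace_mulC; set v := mxvec x.
rewrite mxE /mxtrace (reindex _ (curry_mxvec_bij _ _)) /=.
under [RHS]eq_bigr => k _ do rewrite mxE.
by rewrite pair_bigA /=; apply: eq_bigr => -[k l] _; rewrite !mxE.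
Qed.
End Parseval.

(** * Complete reducibility of unitary corepresentations *)

Section ScalarMatrices.
Variables (R : realType) (A : hopfStarType R).
Local Notation smx := (@smx R A _ _).

Lemma smxE m n (M : 'M[R[i]]_(m, n)) : smx M = map_mx (in_alg A) M.
Proof. by []. Qed.

Lemma smxM m n p (M : 'M[R[i]]_(m, n)) (N : 'M_(n, p)) :
  smx (M *m N) = smx M *m smx N.
Proof. by rewrite !smxE map_mxM. Qed.

Lemma smx1 n : smx (1%:M : 'M[R[i]]_n) = 1%:M.
Proof. by rewrite smxE map_mx1. Qed.

Lemma smx0 m n : smx (0 : 'M[R[i]]_(m, n)) = 0.
Proof. by rewrite smxE map_mx0. Qed.

Lemma smxD m n (M N : 'M[R[i]]_(m, n)) : smx (M + N) = smx M + smx N.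
Proof. by rewrite !smxE map_mxD. Qed.

Lemma mul_smxl m n p (M : 'M[R[i]]_(m, n)) (X : 'M[A]_(n, p)) i j :
  (smx M *m X) i j = \sum_k M i k *: X k j.
Proof. by rewrite mxE; apply: eq_bigr => k _; rewrite mxE mulr_algl. Qed.

Lemma mul_smxr m n p (X : 'M[A]_(m, n)) (M : 'M[R[i]]_(n, p)) i j :
  (X *m smx M) i j = \sum_k M k j *: X i k.
Proof. by rewrite mxE; apply: eq_bigr => k _; rewrite mxE mulr_algr. Qed.

Lemma star1 : star (1 : A) = 1.
Proof. by rewrite -[LHS]mulr1 -{2}[1](@starK R A) -starM mulr1 starK. Qed.

Lemma star_alg c : star (c%:A : A) = (Num.conj c)%:A.
Proof. by rewrite starZ star1 conjCE. Qed.

Lemma starmxM m n p (X : 'M[A]_(m, n)) (Y : 'M[A]_(n, p)) :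
  starmx (X *m Y) = starmx Y *m starmx X.
Proof.
apply/matrixP => i j; rewrite !mxE raddf_sum; apply: eq_bigr => k _.
by rewrite /= !mxE starM.
Qed.

Lemma starmx_smx m n (M : 'M[R[i]]_(m, n)) : starmx (smx M) = smx M^†.
Proof. by apply/matrixP => i j; rewrite !mxE star_alg. Qed.

Lemma starmx1 n : starmx (1%:M : 'M[A]_n) = 1%:M.
Proof. by rewrite -smx1 starmx_smx trmx1 map_mx1. Qed.

Lemma starmxK m n (X : 'M[A]_(m, n)) : starmx (starmx X) = X.
Proof. by apply/matrixP => i j; rewrite !mxE starK. Qed.

Lemma starmx_bar m n (X : 'M[A]_(m, n)) : starmx (map_mx star X) = X^T.
Proof. by apply/matrixP => i j; rewrite !mxE starK. Qed.

Lemma bar_smx_mul m n p (M : 'M[R[i]]_(m, n)) (X : 'M[A]_(n, p)) :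
  map_mx star (smx M *m X) = smx (map_mx Num.conj M) *m map_mx star X.
Proof.
apply/matrixP => i j; rewrite mxE !mul_smxl raddf_sum; apply: eq_bigr => k _.
by rewrite /= starZ !mxE.
Qed.

Lemma bar_mul_smx m n p (X : 'M[A]_(m, n)) (M : 'M[R[i]]_(n, p)) :
  map_mx star (X *m smx M) = map_mx star X *m smx (map_mx Num.conj M).
Proof.
apply/matrixP => i j; rewrite mxE !mul_smxr raddf_sum; apply: eq_bigr => k _.
by rewrite /= starZ !mxE.
Qed.

Lemma smx_mul_ind (P : A -> Prop) m n p q (M : 'M[R[i]]_(m, n))
    (X : 'M[A]_(n, p)) (N : 'M[R[i]]_(p, q)) : P 0 ->
  (forall a b, P a -> P b -> P (a + b)) -> (forall c a, P a -> P (c *: a)) ->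
  (forall i j, P (X i j)) -> forall i j, P ((smx M *m X *m smx N) i j).
Proof.
move=> P0 PD PZ PX i j; rewrite mul_smxr; elim/big_ind: _ => // l _.
by apply: (PZ); rewrite mul_smxl; elim/big_ind: _ => // k _; apply: PZ.
Qed.

(* U is a unitary corepresentation and the columns of B are an orthonormal basis
   of an invariant subspace, on which U acts by X. *)
Section Subcorepresentation.
Variables (n k : nat) (U : 'M[A]_n) (B : 'M[R[i]]_(n, k)) (X : 'M[A]_k).
Hypotheses (BB : B^† *m B = 1%:M) (UB : U *m smx B = smx B *m X).

Lemma subcorep_eq : X = smx B^† *m U *m smx B.
Proof. by rewrite -mulmxA UB mulmxA -smxM BB smx1 mul1mx. Qed.

Lemma subcorepP : corepresentation U -> corepresentation X.
Proof.
move=> [cU eU]; split=> i j.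
  pose Y := smx B^† *m U.
  have cX : comul (X i j) = \sum_c Y i c ⊗t (U *m smx B) c j.
    rewrite {1}subcorep_eq mul_smxr raddf_sum /=.
    under eq_bigr => b _.
      rewrite linearZ mul_smxl raddf_sum /=.
      under eq_bigr => a _ do rewrite linearZ /= cU scaler_sumr.
      rewrite exchange_big /= scaler_sumr.
      under eq_bigr => c _.
        under eq_bigr => a _ do rewrite tpureZl.
        rewrite -tpure_suml -mul_smxl -/Y tpureZr; over.
      over.
    rewrite exchange_big /=; apply: eq_bigr => c _.
    by rewrite mul_smxr tpure_sumr.
  rewrite cX UB; under eq_bigr => c _ do rewrite mul_smxl tpure_sumr.
  rewrite exchange_big /=; apply: eq_bigr => l _.
  rewrite subcorep_eq -/Y [in RHS]mul_smxr tpure_suml; apply: eq_bigr => c _.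
  by rewrite -tpureZr tpureZl.
have /(congr1 (map_mx (@counit R A))) := subcorep_eq.
move=> /matrixP/(_ i j); rewrite mxE => ->; rewrite mxE mul_smxr raddf_sum /=.
have /matrixP/(_ i j) := BB; rewrite [in X in _ = X -> _]mxE => <-.
rewrite mxE; apply: eq_bigr => b _; rewrite linearZ /= mulrC; congr (_ * _).
rewrite mul_smxl raddf_sum /= (bigD1 b) //= linearZ /= eU eqxx mulr1.
rewrite big1 ?addr0 // => a ab; rewrite linearZ /= eU.
by rewrite (negbTE ab) mulr0.
Qed.

(** X is an isometry by restriction, and unitary because it is invertible: its
    antipode is an inverse. Then B^† intertwines U and X as well, so the
    orthogonal complement of an invariant subspace is invariant. *)
Lemma subcorep_unitary : unitary_corep U ->
  unitary_corep X /\ smx B^† *m U = X *m smx B^†.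
Proof.
move=> [cU [sU Us]]; have cX := subcorepP cU.
have sX : starmx X *m X = 1%:M.
  have := congr1 (fun Z => starmx Z *m Z) UB.
  rewrite !starmxM !starmx_smx -!mulmxA (mulmxA (starmx U)) sU mul1mx.
  by rewrite (mulmxA (smx B^†)) -smxM BB smx1 mul1mx.
have Xs : X *m starmx X = 1%:M.
  have := corep_antipoder cX; set Z := map_mx _ X => XZ.
  suff -> : starmx X = Z by [].
  by rewrite -[LHS]mulmx1 -XZ mulmxA sX mul1mx.
split=> //.
have : starmx U *m smx B = smx B *m starmx X.
  rewrite -[LHS]mulmx1 -Xs mulmxA -(mulmxA _ _ X) -UB mulmxA sU.
  by rewrite mul1mx.
move=> /(congr1 (@starmx R A _ _)); rewrite !starmxM !starmx_smx => E.
by rewrite !starmxK in E.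
Qed.
End Subcorepresentation.
End ScalarMatrices.

Section Reduction.
Variables (R : realType) (A : hopfStarType R).
Local Notation smx := (@smx R A _ _).

(** Orthonormal bases B1 of the column space of B and B2 of its orthogonal
    complement. *)
Lemma orthonormal_split n k (B : 'M[R[i]]_(n, k)) :
  (0 < \rank B)%N -> (\rank B < n)%N ->
  exists p q (B1 : 'M[R[i]]_(n, p)) (B2 : 'M[R[i]]_(n, q)),
  [/\ (p < n)%N /\ (q < n)%N, B1^† *m B1 = 1%:M, B2^† *m B2 = 1%:M,
      B1^† *m B2 = 0 /\ B1 *m B1^† + B2 *m B2^† = 1%:M &
      exists T T', B1 = B *m T /\ B = B1 *m T'].
Proof.
move=> B0 Bn; pose V := B^T.
have rV : \rank V = \rank B by rewrite mxrank_tr.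
have := schmidt_complete_unitarymx V; rewrite /schmidt_complete.
have := rank_ortho V; set H := orthomx _ _ _ => rH.
set W1 := schmidt (row_base V); set W2 := schmidt _ => W12.
have pq : (\rank V + \rank H = n)%N by rewrite rH subnKC // rank_leq_col.
have trE m1 m2 (M : 'M[R[i]]_(m1, n)) (N : 'M[R[i]]_(m2, n)) :
    (M^T)^† *m N^T = map_mx Num.conj (M *m N^†).
  by rewrite map_mxM -map_mx_comp trmxK (map_mx_id (@conjCK _)).
have /unitarymxP := W12; rewrite tr_col_mx map_row_mx mul_col_row.
rewrite scalar_mx_block => /eq_block_mx[W11 W1W2 _ W22].
exists (\rank V), (\rank H), W1^T, W2^T; split.
- rewrite rV Bn; split=> //; rewrite rH rV ltn_subrL B0.
  exact: leq_ltn_trans Bn.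
- by rewrite trE W11 map_mx1.
- by rewrite trE W22 map_mx1.
- split; first by rewrite trE W1W2 map_mx0.
  have := mulmxKtV 1%:M W12 pq.
  rewrite mul1mx tr_col_mx map_row_mx mul_row_col => /(congr1 trmx).
  rewrite trmx1 linearD /= !trmx_mul => <-.
  by rewrite ![(map_mx _ _)^T]map_trmx !trmxK.
have W1V : (W1 :=: V)%MS.
  exact/(eqmx_trans (eqmx_schmidt_free (row_base_free V)))/eq_row_base.
have /submxP[D W1D] : (W1 <= V)%MS by rewrite W1V.
have /submxP[D' VD'] : (V <= W1)%MS by rewrite W1V.
exists D^T, D'^T; split; first by rewrite W1D trmx_mul trmxK.
by rewrite -trmx_mul -VD' trmxK.
Qed.

(** Complete reducibility, as an induction principle: splitting off an invariant
    subspace and its complement writes the coefficients of U as combinations of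
    those of two smaller unitary corepresentations. *)
Lemma irreducible_ind (P : A -> Prop) : P 0 ->
  (forall a b, P a -> P b -> P (a + b)) ->
  (forall c a, P a -> P (c *: a)) ->
  (forall n (U : 'M[A]_n) i j, unitary_corep U -> irreducible U -> P (U i j)) ->
  forall n (U : 'M[A]_n) i j, unitary_corep U -> P (U i j).
Proof.
move=> P0 PD PZ Pirr n; have [m le_nm] := ubnP n; elim: m => // m IH in n le_nm *.
move=> U i j uU.
have n0 : (0 < n)%N by apply: leq_ltn_trans (ltn_ord i).
have [irr|/not_andP[//|/existsNP[k /existsNP[B]]]] := pselect (irreducible U).
  exact: Pirr.
move=> /not_implyP[[rB [X UB]] /not_orP[/eqP k0 /eqP kn]].
have B0 : (0 < \rank B)%N by rewrite rB lt0n.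
have Bn : (\rank B < n)%N by rewrite ltn_neqAle rB kn -{1}rB rank_leq_row.
have [p [q [B1 [B2 [[pn qn] B11 B22 [B12 Bsum] [T [T' [B1E BE]]]]]]]] :=
  orthonormal_split B0 Bn.
have UB1 : U *m smx B1 = smx B1 *m (smx T' *m X *m smx T).
  by rewrite {1}B1E smxM mulmxA UB {1}BE smxM !mulmxA.
set X1 := _ *m X *m _ in UB1.
have [uX1 U1] := subcorep_unitary B11 UB1 uU.
have UB2 : U *m smx B2 = smx B2 *m (smx B2^† *m U *m smx B2).
  rewrite -[LHS]mul1mx -smx1 -Bsum smxD !smxM mulmxDl -!mulmxA.
  rewrite (mulmxA (smx B1^†)) U1 -(mulmxA _ (smx B1^†)) -smxM B12 smx0.
  by rewrite !mulmx0 add0r.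
set X2 := _ *m U *m _ in UB2.
have [uX2 U2] := subcorep_unitary B22 UB2 uU.
have -> : U = smx B1 *m X1 *m smx B1^† + smx B2 *m X2 *m smx B2^†.
  by rewrite -UB1 -UB2 -!mulmxA -mulmxDr -!smxM -smxD Bsum smx1 mulmx1.
rewrite mxE; apply: (PD); apply: smx_mul_ind => // a b; apply: IH => //.
  exact: leq_trans pn _.
exact: leq_trans qn _.
Qed.
End Reduction.

(** * Unitarizability of corepresentations *)

Section ScalarForms.
Variables (R : realType) (A : hopfStarType R).
Implicit Types f g : A -> R[i].

Section OneForm.
Variable f : A -> R[i].
Hypothesis fs : scalar f.

Lemma scalarD a b : f (a + b) = f a + f b.
Proof. by rewrite -{1}[a]scale1r fs mul1r. Qed.

Lemma scalar0 : f 0 = 0.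
Proof. by apply: (addrI (f 0)); rewrite -scalarD !addr0. Qed.

Lemma scalarZ c a : f (c *: a) = c * f a.
Proof. by rewrite -[c *: a]addr0 fs scalar0 addr0. Qed.

Lemma scalar_sum (I : finType) (F : I -> A) : f (\sum_i F i) = \sum_i f (F i).
Proof. exact: (big_morph f scalarD scalar0). Qed.
End OneForm.

Lemma scalar_lincomb (I : finType) (c : I -> R[i]) (f : I -> A -> R[i]) :
  (forall i, scalar (f i)) -> scalar (fun a => \sum_i c i * f i a).
Proof.
move=> fs d a b; rewrite mulr_sumr -big_split; apply: eq_bigr => i _ /=.
by rewrite fs mulrDr mulrCA.
Qed.

(** Convolution of linear forms; evaluating forms at the entries of a
    corepresentation turns it into the matrix product. *)
Definition conv f g (a : A) : R[i] := tlift (fun x y => f x * g y) (comul a).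

Lemma balanced_conv f g : scalar f -> scalar g -> balanced (fun x y => f x * g y).
Proof.
move=> fs gs; split=> *; rewrite ?scalarD ?mulrDl ?mulrDr //.
by rewrite !scalarZ // mulrCA mulrA.
Qed.

Lemma conv_scalar f g : scalar f -> scalar g -> scalar (conv f g).
Proof.
move=> fs gs; have bfg := balanced_conv fs gs.
move=> c a b; rewrite /conv linearP /= tliftD //; congr (_ + _).
elim/tensor_ind: (comul a) => [|x y|x y Hx Hy].
- by rewrite scaler0 tlift0 // mulr0.
- by rewrite tpureZl !tlift_pure // scalarZ // mulrA.
- by rewrite scalerDr !tliftD // Hx Hy mulrDr.
Qed.

Lemma conv_corep n (Y : 'M[A]_n) f g : scalar f -> scalar g ->
  corepresentation Y -> map_mx (conv f g) Y = map_mx f Y *m map_mx g Y.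
Proof.
move=> fs gs [cY _]; apply/matrixP => i j; rewrite !mxE /conv cY.
rewrite tlift_sum_pure; last exact: balanced_conv.
by apply: eq_bigr => k _; rewrite !mxE.
Qed.

(** The involution of the convolution algebra; evaluation at a unitary
    corepresentation turns it into the conjugate transpose. *)
Definition dag f (a : A) : R[i] := Num.conj (f (star (antipode a))).

Lemma dag_scalar f : scalar f -> scalar (dag f).
Proof.
move=> fs c a b; rewrite /dag linearP raddfD /= starZ.
by rewrite scalarD // scalarZ // rmorphD rmorphM /= -conjCE conjCK.
Qed.

Lemma dag_unitary n (W : 'M[A]_n) f : unitary_corep W ->
  map_mx (dag f) W = (map_mx f W)^†.
Proof.
move=> uW; apply/matrixP => i j.
by rewrite !mxE /dag (unitary_corep_antipode uW) starK.
Qed.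

(** Membership of a in the linear span of the entries of W, in dual form:
    it yields identities between values of forms without choosing coordinates. *)
Definition determined n (W : 'M[A]_n) (a : A) : Prop :=
  forall f, scalar f -> (forall k l, f (W k l) = 0) -> f a = 0.

Lemma determined_eq n (W : 'M[A]_n) a f g : determined W a ->
  scalar f -> scalar g -> map_mx f W = map_mx g W -> f a = g a.
Proof.
move=> Wa fs gs fgW; apply/eqP; rewrite -subr_eq0; apply/eqP.
apply: (Wa (fun x => f x - g x)) => [c x y|k l].
  by rewrite fs gs mulrBr opprD addrACA.
by have /matrixP/(_ k l) := fgW; rewrite !mxE => ->; rewrite subrr.
Qed.

Lemma determined_dag n (W : 'M[A]_n) a : unitary_corep W ->
  determined W a -> determined W (star (antipode a)).
Proof.
move=> uW Wa f fs fW; apply/eqP; rewrite -conjC_eq0; apply/eqP.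
apply: (Wa (dag f)) => [|k l]; first exact: dag_scalar.
by rewrite /dag (unitary_corep_antipode uW) starK fW conjC0.
Qed.

Lemma block_unitary_corep p q (V : 'M[A]_p) (W : 'M[A]_q) :
  unitary_corep V -> unitary_corep W -> unitary_corep (block_mx V 0 0 W).
Proof.
move=> [[cV eV] [sV Vs]] [[cW eW] [sW Ws]].
have starE : starmx (block_mx V 0 0 W) = block_mx (starmx V) 0 0 (starmx W).
  have star0 m n : map_mx (@star R A) (0 : 'M[A]_(m, n)) = 0.
    by apply/matrixP => i j; rewrite !mxE raddf0.
  by rewrite /starmx map_block_mx tr_block_mx !star0 !trmx0.
split; split.
- move=> i j; rewrite big_split_ord /=.
  case: (split_ordP i) => {}i ->; case: (split_ordP j) => {}j ->;
  rewrite ?(block_mxEul, block_mxEur, block_mxEdl, block_mxEdr).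
  + rewrite cV [X in _ + X]big1 ?addr0 => [|k _]; last first.
      by rewrite block_mxEur block_mxEdl mxE tpure0l.
    by apply: eq_bigr => k _; rewrite !block_mxEul.
  + rewrite mxE raddf0 !big1 ?addr0 // => k _.
      by rewrite ?(block_mxEul, block_mxEur, block_mxEdl, block_mxEdr) mxE ?tpure0l ?tpure0r.
    by rewrite ?(block_mxEul, block_mxEur, block_mxEdl, block_mxEdr) mxE ?tpure0l ?tpure0r.
  + rewrite mxE raddf0 !big1 ?addr0 // => k _.
      by rewrite ?(block_mxEul, block_mxEur, block_mxEdl, block_mxEdr) mxE ?tpure0l ?tpure0r.
    by rewrite ?(block_mxEul, block_mxEur, block_mxEdl, block_mxEdr) mxE ?tpure0l ?tpure0r.
  + rewrite cW [X in X + _]big1 ?add0r => [|k _]; last first.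
      by rewrite block_mxEur block_mxEdl mxE tpure0l.
    by apply: eq_bigr => k _; rewrite !block_mxEdr.
- move=> i j.
  case: (split_ordP i) => {}i ->; case: (split_ordP j) => {}j ->;
  rewrite ?(block_mxEul, block_mxEur, block_mxEdl, block_mxEdr) ?mxE ?raddf0.
  + by rewrite eV eq_lshift.
  + by rewrite eq_lrshift.
  + by rewrite eq_rlshift.
  + by rewrite eW eq_rshift.
- by rewrite starE mulmx_block !mulmx0 !mul0mx !addr0 add0r sV sW -scalar_mx_block.
- by rewrite starE mulmx_block !mulmx0 !mul0mx !addr0 add0r Vs Ws -scalar_mx_block.
Qed.

Lemma determined_blockl p q (V : 'M[A]_p) (W : 'M[A]_q) a :
  determined V a -> determined (block_mx V 0 0 W) a.
Proof.
move=> Va f fs fVW; apply: Va => // k l.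
by have := fVW (lshift _ k) (lshift _ l); rewrite block_mxEul.
Qed.

Lemma determined_blockr p q (V : 'M[A]_p) (W : 'M[A]_q) a :
  determined W a -> determined (block_mx V 0 0 W) a.
Proof.
move=> Wa f fs fVW; apply: Wa => // k l.
by have := fVW (rshift _ k) (rshift _ l); rewrite block_mxEdr.
Qed.
End ScalarForms.

Section Unitarizable.
Variables (R : realType) (A : cqgType R).
Local Notation smx := (@smx R A _ _).

Lemma unitary_corep0 : unitary_corep (0 : 'M[A]_0).
Proof. by split; split; first [by case|by apply/matrixP => -[]]. Qed.

Lemma determined_exists (a : A) :
  exists N (W : 'M[A]_N), unitary_corep W /\ determined W a.
Proof.
elim/cqg_ind: a => [|a b [N [V [uV Va]]] [M [W [uW Wb]]]|c a [N [W [uW Wa]]]|].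
- by exists 0%N, 0; split; [exact: unitary_corep0|move=> f fs _; rewrite scalar0].
- exists (N + M)%N, (block_mx V 0 0 W); split; first exact: block_unitary_corep.
  move=> f fs fVW; rewrite scalarD // (determined_blockl Va fs fVW).
  by rewrite (determined_blockr Wb fs fVW) addr0.
- exists N, W; split=> // f fs fW; rewrite scalarZ // (Wa f fs fW).
  by rewrite mulr0.
- by move=> n U i j uU; exists n, U; split=> // f fs ->.
Qed.

(** One unitary corepresentation, a direct sum, serves for finitely many elements
    at once. *)
Lemma determined_exists_seq (s : seq A) :
  exists N (W : 'M[A]_N), unitary_corep W /\ forall a, a \in s -> determined W a.
Proof.
elim: s => [|a s [N [W [uW Ws]]]]; first by exists 0%N, 0; split=> //; exact: unitary_corep0.
have [M [V [uV Va]]] := determined_exists a.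
exists (M + N)%N, (block_mx V 0 0 W); split; first exact: block_unitary_corep.
move=> b; rewrite inE => /orP[/eqP ->|/Ws]; first exact: determined_blockl.
exact: determined_blockr.
Qed.

Lemma bar_corep n (U : 'M[A]_n) :
  corepresentation U -> corepresentation (map_mx star U).
Proof.
move=> [cU eU]; split=> i j; rewrite mxE.
  rewrite comul_star cU /tmap tlift_sum_pure; last exact: balanced_star.
  by apply: eq_bigr => k _; rewrite !mxE.
by rewrite counit_star eU conjc_nat.
Qed.

Lemma contragredient_corep n (Y : 'M[A]_n) :
  corepresentation Y -> corepresentation (starmx (map_mx antipode Y)).
Proof.
move=> [cY eY]; split=> i j; rewrite !mxE.
  rewrite comul_star comul_antipode cY.
  rewrite tlift_sum_pure; last exact: balanced_antipode_flip.
  rewrite /tmap tlift_sum_pure; last exact: balanced_star.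
  by apply: eq_bigr => k _; rewrite !mxE.
by rewrite counit_star counit_antipode eY conjc_nat eq_sym.
Qed.

(** Every corepresentation Y is equivalent to a unitary one, F being the square of
    the intertwiner. Choose a unitary W whose coefficients span those of Y. The
    matrices f(W), for f a linear form on A, form a unital *-subalgebra M of the
    N x N matrices, and f(W) |-> f(Y) is a representation of M. Averaging over M
    plays the role of averaging over a unitary group: if (a_i) is an orthonormal
    basis of M then sum_i a_i ⊗ a_i^† commutes with M, that is
      sum_i x a_i ⊗ a_i^† = sum_i a_i ⊗ a_i^† x    for x in M.
    Writing a_i = f_i(W) and G_i = f_i^dag(Y), the matrix F = sum_i G_i^† G_i
    therefore intertwines Y and the adjoint of its inverse. It is positive definite
    because M contains the identity. *)
Lemma corep_unitarizable n (Y : 'M[A]_n) : corepresentation Y ->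
  exists F : 'M[R[i]]_n,
  [/\ F^† = F, forall v : 'cV_n, v != 0 -> 0 < (v^† *m F *m v) 0 0
    & starmx Y *m smx F *m Y = smx F].
Proof.
move=> cY; have [N [W [uW detW]]] := determined_exists_seq [seq Y p.1 p.2 | p : 'I_n * 'I_n].
have {}detW i j : determined W (Y i j).
  by apply: detW; apply/mapP; exists (i, j); rewrite ?mem_enum.
have cW := uW.1.
pose Yt := starmx (map_mx antipode Y); have cYt := contragredient_corep cY : corepresentation Yt.
have detWt i j : determined W (Yt i j) by rewrite !mxE; apply: determined_dag.
(* the *-algebra M *)
pose P (x : 'M[R[i]]_N) := exists f, scalar f /\ x = map_mx f W.
have sP : subspace P.
  split.
  - exists (fun=> 0); split=> [c a b|]; first by rewrite mulr0 addr0.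
    by apply/matrixP => i j; rewrite !mxE.
  - move=> _ _ [f [fs ->]] [g [gs ->]]; exists (fun a => f a + g a).
    split=> [c a b|]; first by rewrite fs gs mulrDr addrACA.
    by apply/matrixP => i j; rewrite !mxE.
  - move=> d _ [f [fs ->]]; exists (fun a => d * f a).
    split=> [c a b|]; first by rewrite fs mulrDr mulrCA.
    by apply/matrixP => i j; rewrite !mxE.
have PM x y : P x -> P y -> P (x *m y).
  move=> [f [fs ->]] [g [gs ->]]; exists (conv f g).
  by split; [exact: conv_scalar|rewrite conv_corep].
have Pdag x : P x -> P (x^†).
  move=> [f [fs ->]]; exists (dag f).
  by split; [exact: dag_scalar|rewrite dag_unitary].
have [d [a [Pa aE]]] := parseval_matrices sP.
have /choice[f fP] : forall i, exists f, scalar f /\ a i = map_mx f W by [].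
have fs i : scalar (f i) by case: (fP i).
have af i : a i = map_mx (f i) W by case: (fP i).
(* the coefficients of both x a_i on (a_j) and a_j^† x on (a_i^†) *)
pose t x j i := \tr ((a j)^† *m x *m a i).
have key1 x i : P x -> x *m a i = \sum_j t x j i *: a j.
  move=> Px; rewrite [LHS]aE; last exact: PM.
  by apply: eq_bigr => j _; rewrite mulmxA.
have dagM m p q (x : 'M[R[i]]_(m, p)) (y : 'M_(p, q)) : (x *m y)^† = y^† *m x^†.
  by rewrite trmx_mul map_mxM.
have mxtrace_dag (x : 'M[R[i]]_N) : \tr (x^†) = Num.conj (\tr x).
  by rewrite trace_map_mx mxtrace_tr.
have dag_comb (c : 'I_d -> R[i]) (b : 'I_d -> 'M[R[i]]_N) :
    (\sum_i c i *: b i)^† = \sum_i Num.conj (c i) *: (b i)^†.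
  rewrite !linear_sum raddf_sum /=; apply: eq_bigr => i _.
  by rewrite linearZ map_mxZ.
have key2 x j : P x -> (a j)^† *m x = \sum_i t x j i *: (a i)^†.
  move=> Px; rewrite -[LHS]trmxCK dagM trmxCK.
  rewrite [in LHS](aE (x^† *m a j)); last by apply: PM => //; apply: Pdag.
  rewrite dag_comb; apply: eq_bigr => i _; congr (_ *: _).
  by rewrite /t -[LHS]mxtrace_dag !dagM !trmxCK.
pose G i := map_mx (dag (f i)) Y.
have GE i : map_mx (f i) Yt = (G i)^†.
  by apply/matrixP => k l; rewrite !mxE /dag conjCK.
pose F := \sum_i (G i)^† *m G i.
(* linear relations between forms pass from W to what its entries span *)
have transfer (g : A -> R[i]) (c : 'I_d -> R[i]) (h : 'I_d -> A -> R[i]) (Z : 'M[A]_n) :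
    scalar g -> (forall i, scalar (h i)) -> (forall k l, determined W (Z k l)) ->
    map_mx g W = \sum_i c i *: map_mx (h i) W ->
    map_mx g Z = \sum_i c i *: map_mx (h i) Z.
  move=> gs hs dZ gW; apply/matrixP => k l; rewrite summxE mxE.
  rewrite (determined_eq (dZ k l) gs (@scalar_lincomb _ _ _ c _ hs)).
    by apply: eq_bigr => i _; rewrite !mxE.
  rewrite gW; apply/matrixP => p q; rewrite summxE mxE.
  by apply: eq_bigr => i _; rewrite !mxE.
have inter g : scalar g -> map_mx g Yt *m F = F *m map_mx g Y.
  move=> gs; pose x := map_mx g W; have Px : P x by exists g.
  rewrite mulmx_sumr mulmx_suml.
  transitivity (\sum_i \sum_j t x j i *: ((G j)^† *m G i)).
    apply: eq_bigr => i _; rewrite mulmxA -GE -conv_corep //.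
    rewrite (transfer _ (fun j => t x j i) f) //; last 1 first.
    - by rewrite conv_corep // -(af i) key1 //; apply: eq_bigr => j _; rewrite (af j).
    - by rewrite mulmx_suml; apply: eq_bigr => j _; rewrite GE scalemxAl.
    - exact: conv_scalar.
  rewrite exchange_big; apply: eq_bigr => j _; rewrite -mulmxA.
  have dfs i : scalar (dag (f i)) by apply: dag_scalar.
  rewrite -conv_corep // (transfer _ (fun i => t x j i) (fun i => dag (f i))) //.
  - by rewrite mulmx_sumr; apply: eq_bigr => i _; rewrite scalemxAr.
  - exact: conv_scalar.
  rewrite (conv_corep (dfs j) gs cW) (dag_unitary (f j) uW) -(af j) key2 //; apply: eq_bigr => i _.
  by rewrite (dag_unitary (f i) uW) (af i).
exists F; split.
- rewrite !linear_sum raddf_sum /=; apply: eq_bigr => i _.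
  by rewrite [LHS]dagM trmxCK.
- move=> v v0.
  have nonneg i : 0 <= (v^† *m ((G i)^† *m G i) *m v) 0 0.
    rewrite mulmxA -mulmxA -dagM mxE sumr_ge0 // => k _.
    by rewrite !mxE mulrC mul_conjC_ge0.
  rewrite mulmx_sumr mulmx_suml summxE lt_def sumr_ge0 // andbT.
  apply: contra v0 => /eqP /psumr_eq0P Gv0.
  have {}Gv0 i : G i *m v = 0.
    apply/colP => k; rewrite [RHS]mxE; apply/eqP; rewrite -mul_conjC_eq0.
    have := Gv0 (fun i _ => nonneg i) i isT.
    rewrite mulmxA -mulmxA -dagM mxE => /psumr_eq0P H.
    have := H (fun l _ => _) k isT; rewrite !mxE mulrC => -> // l.
    by rewrite !mxE mulrC mul_conjC_ge0.
  (* the counit expresses the identity as a combination of the G_i, which all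
     kill v *)
  have es : scalar (@counit R A) by exact: counit_linear.
  have eC p (Z : 'M[A]_p) : corepresentation Z -> map_mx (@counit R A) Z = 1%:M.
    by move=> [_ eZ]; apply/matrixP => i j; rewrite !mxE eZ.
  have P1 : P 1%:M by exists (@counit R A); rewrite eC.
  pose c i := Num.conj (\tr ((a i)^† *m 1%:M)).
  have := transfer (@counit R A) c (fun i => dag (f i)) Y.
  rewrite !eC // => E; rewrite -[v]mul1mx E //.
  + by rewrite mulmx_suml big1 // => i _; rewrite -scalemxAl Gv0 scaler0.
  + by move=> i; apply: dag_scalar.
  rewrite -[LHS]trmxCK trmx1 map_mx1 [in LHS](aE _ P1) dag_comb.
  by apply: eq_bigr => i _; rewrite (dag_unitary (f i) uW) -(af i).
(* forms separate the points of A, so the intertwining relation holds in A *)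
have YtF : Yt *m smx F = smx F *m Y.
  apply/matrixP => i j; apply/eqP; rewrite -subr_eq0; apply/eqP.
  apply: scalar_forms_separate => g gs.
  rewrite -scaleN1r scalarD // scalarZ // mulN1r mul_smxl mul_smxr !scalar_sum //.
  apply/eqP; rewrite subr_eq0; apply/eqP.
  have /matrixP/(_ i j) := inter g gs; rewrite !mxE.
  under eq_bigr => k _ do rewrite mxE mulrC.
  under [X in _ = X -> _]eq_bigr => k _ do rewrite mxE.
  by move=> E; under eq_bigr => k _ do rewrite scalarZ //;
     under [RHS]eq_bigr => k _ do rewrite scalarZ //.
rewrite -mulmxA -YtF mulmxA -starmxM corep_antipodel //.
by rewrite starmx1 mul1mx.
Qed.
End Unitarizable.

(** * Modular matrices and the scaling group *)

Section ModularMatrix.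
Variables (R : realType) (A : cqgType R).
Local Notation smx := (@smx R A _ _).
Local Notation toC := (fun x : R => x%:C%C).

(** The hypothesis on D says that D conjugates the antipode of the matrix of
    u_ij^* to the transpose of U, and S(u_ij) = u_ji^*. *)
Lemma antipode2_modular n (U : 'M[A]_n) (D : 'rV[R[i]]_n) :
  unitary_corep U -> (forall i, D 0 i != 0) ->
  U^T *m smx (diag_mx D) *m map_mx star U = smx (diag_mx D) ->
  forall i j, antipode (antipode (U i j)) = (D 0 i / D 0 j) *: U i j.
Proof.
move=> uU D0 UDU i j; have cbU := bar_corep uU.1.
have : U^T *m smx (diag_mx D) = smx (diag_mx D) *m map_mx antipode (map_mx star U).
  by rewrite -[in RHS]UDU -[RHS]mulmxA corep_antipoder // mulmx1.
move=> /matrixP/(_ j i); rewrite mul_smxl mul_smxr.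
rewrite (bigD1 i) //= big1 => [|k ki]; last by rewrite mxE (negbTE ki) scale0r.
rewrite (bigD1 j) //= [in RHS]big1 => [|k kj]; last first.
  by rewrite mxE eq_sym (negbTE kj) scale0r.
rewrite !mxE !eqxx !addr0 !mulr1n -(unitary_corep_antipode uU) => E.
by rewrite mulrC -scalerA E scalerA mulVf // scale1r.
Qed.

(** Diagonalise the positive matrix F attached to the conjugate corepresentation
    by a unitary change of basis. Up to a scalar, the modular matrix Q is the
    square root of the resulting diagonal matrix D, so S^2 acts on coefficients
    by D_i / D_j = (q_i / q_j)^2. *)
Lemma modular_diagonalization n (U : 'M[A]_n) :
  unitary_corep U -> irreducible U ->
  exists (T : 'M[R[i]]_n) (V : 'M[A]_n) (q : 'rV[R]_n),
  [/\ unitary_corep V /\ irreducible V, forall i, 0 < q 0 i,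
      modular_matrix V (diag_mx (map_mx toC q)),
      forall i j, antipode (antipode (V i j)) = ((q 0 i / q 0 j) ^+ 2)%:C%C *: V i j
    & U = smx T *m V *m smx T^†].
Proof.
move=> uU irrU; have n0 := irrU.1.
have [F [Fherm Fpos UFU]] := corep_unitarizable (bar_corep uU.1).
rewrite starmx_bar in UFU.
have Fnormal : F \is normalmx by apply/normalmxP; rewrite Fherm.
pose P := spectralmx F; pose D := spectral_diag F.
have uP : P \is unitarymx by apply: spectral_unitarymx.
have PP : P *m P^† = 1%:M by apply/unitarymxP.
have P'P : P^† *m P = 1%:M by rewrite -invmx_unitary // mulVmx // unitarymx_unit.
have FE : F = P^† *m diag_mx D *m P.
  by rewrite -(invmx_unitary uP); apply/orthomx_spectralP.
pose r i := complex.Re (D 0 i).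
have Dpos i : 0 < D 0 i.
  pose v : 'cV[R[i]]_n := P^† *m delta_mx i 0.
  have v0 : v != 0.
    apply/eqP => /(congr1 (mulmx P)); rewrite mulmxA PP mul1mx mulmx0.
    by move=> /matrixP/(_ i 0); rewrite !mxE !eqxx => /eqP; rewrite oner_eq0.
  have := Fpos v v0; rewrite FE /v trmx_mul map_mxM trmxCK -!mulmxA.
  rewrite (mulmxA P) PP mul1mx (mulmxA P) PP mul1mx.
  rewrite trmx_delta map_delta_mx -rowE mxE mul_diag_mx !mxE !eqxx.
  by rewrite mulr1.
have Dr i : D 0 i = (r i)%:C%C.
  by have := Dpos i; rewrite ltcE /r => /andP[/eqP Im0 _]; case: (D 0 i) Im0 => x y /= ->.
have rpos i : 0 < r i by rewrite -ltcR -Dr.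
pose s i := Num.sqrt (r i); have spos i : 0 < s i by rewrite sqrtr_gt0.
have s2 i : s i ^+ 2 = r i by rewrite sqr_sqrtr // ltW.
have sum_pos (f : 'I_n -> R) : (forall i, 0 < f i) -> 0 < \sum_i f i.
  move=> fpos; rewrite (bigD1 (Ordinal n0)) //= ltr_wpDr //.
  by apply: sumr_ge0 => i _; apply: ltW.
pose s1 := \sum_i s i; have s1pos : 0 < s1 by apply: sum_pos.
pose sV := \sum_i (s i)^-1.
have sVpos : 0 < sV by apply: sum_pos => i; rewrite invr_gt0.
(* this factor makes the traces of Q and of its inverse agree *)
pose c := Num.sqrt (sV / s1); have cpos : 0 < c by rewrite sqrtr_gt0 divr_gt0.
have c2 : c ^+ 2 = sV / s1 by rewrite sqr_sqrtr // ltW // divr_gt0.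
pose q : 'rV[R]_n := \row_i (c * s i).
have qpos i : 0 < q 0 i by rewrite mxE mulr_gt0.
have q0 i : q 0 i != 0 by rewrite gt_eqF.
pose Q := diag_mx (map_mx toC q); pose Qi := diag_mx (map_mx toC (map_mx GRing.inv q)).
have QQi : Q *m Qi = 1%:M.
  rewrite mulmx_diag; apply/matrixP => i j; rewrite !mxE; congr (_ *+ _).
  by rewrite -rmorphM divff ?rmorph1 // mulf_neq0 ?gt_eqF.
have Qunit : Q \in unitmx by have [] := mulmx1_unit QQi.
have QiE : invmx Q = Qi by rewrite -[LHS]mulmx1 -QQi mulmxA mulVmx // mul1mx.
have QiQ : Qi *m Q = 1%:M by rewrite -QiE mulVmx.
have QQ : Q *m Q = (c ^+ 2)%:C%C%:M *m diag_mx D.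
  rewrite mulmx_diag mul_scalar_mx; apply/matrixP => i j; rewrite !mxE /= mulrnAr.
  by rewrite Dr -s2 -!rmorphM /= -expr2 exprMn.
have dag_diag (e : 'rV[R]_n) : (diag_mx (map_mx toC e))^† = diag_mx (map_mx toC e).
  rewrite tr_diag_mx map_diag_mx; congr diag_mx; apply/matrixP => i j.
  by rewrite !mxE; apply: conjc_real.
pose B := P^T.
have BB' : B *m B^† = 1%:M.
  by have := congr1 trmx P'P; rewrite trmx_mul map_trmx trmx1.
have BB : B^† *m B = 1%:M by apply: mulmx1C.
pose V := smx B^† *m U *m smx B.
have UB : U *m smx B = smx B *m V.
  by rewrite /V !mulmxA -smxM BB' smx1 mul1mx.
have [uV _] := subcorep_unitary BB UB uU.
have barV : map_mx star V = smx P *m map_mx star U *m smx P^†.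
  rewrite /V bar_mul_smx bar_smx_mul -map_mx_comp (map_mx_id (@conjCK _)).
  by rewrite trmxK.
clearbody V.
have VDV : V^T *m smx (diag_mx D) *m map_mx star V = smx (diag_mx D).
  rewrite -starmx_bar barV !starmxM !starmx_smx trmxCK starmx_bar.
  transitivity (smx P *m (U^T *m smx F *m map_mx star U) *m smx P^†).
    by rewrite FE !smxM !mulmxA.
  rewrite UFU -!smxM FE !mulmxA PP mul1mx -mulmxA PP mulmx1 //.
have cV := uV.1.
exists B, V, q; split=> //.
- split=> //; split=> // k C [rC [X VC]]; apply: irrU.2 (B *m C) _; split.
    apply/eqP; rewrite eqn_leq -[X in (_ <= X)%N]rC mxrankM_maxr -[in X in (X <= _)%N]rC.
    by rewrite -{1}[C]mul1mx -BB -mulmxA mxrankM_maxr.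
  by exists X; rewrite !smxM mulmxA UB -(mulmxA _ V) VC mulmxA.
- rewrite -/Q; split=> //.
  + move=> v; rewrite mul_mx_diag mxE; apply: sumr_ge0 => k _.
    rewrite !mxE mulrAC; apply: mulr_ge0; last by rewrite ler0c ltW // mulr_gt0.
    by rewrite mulrC mul_conjC_ge0.
  + rewrite QiE !mxtrace_diag.
    under eq_bigr => i _ do rewrite !mxE rmorphM.
    under [RHS]eq_bigr => i _ do rewrite !mxE invfM rmorphM.
    rewrite -!mulr_sumr -!rmorph_sum -!rmorphM; congr (_%:C)%C.
    rewrite -/s1 -/sV; apply: (mulfI (lt0r_neq0 cpos)).
    by rewrite mulVKf ?gt_eqF // mulrA -expr2 c2 divfK // gt_eqF.
  rewrite QiE; set Y := _ *m smx Qi.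
  have sY : starmx Y *m Y = 1%:M.
    have comm k : V^T *m smx k%:M = smx k%:M *m V^T.
      apply/matrixP => i j; rewrite mul_smxl mul_smxr.
      rewrite (bigD1 j) //= big1 => [|l lj]; last by rewrite mxE (negbTE lj) scale0r.
      rewrite (bigD1 i) //= [in RHS]big1 => [|l li]; last first.
        by rewrite mxE eq_sym (negbTE li) scale0r.
      by rewrite !mxE !eqxx.
    (* Q ^ 2 is a multiple of D *)
    have VQQV : V^T *m smx (Q *m Q) *m map_mx star V = smx (Q *m Q).
      by rewrite QQ smxM mulmxA comm -2!mulmxA (mulmxA V^T) VDV.
    rewrite /Y !starmxM !starmx_smx !dag_diag starmx_bar -/Q -/Qi.
    transitivity (smx Qi *m (V^T *m smx (Q *m Q) *m map_mx star V) *m smx Qi).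
      by rewrite smxM !mulmxA.
    by rewrite VQQV -!smxM mulmxA QiQ mul1mx QQi smx1.
  (* Y has a right inverse Z, so its left inverse is also a right one *)
  split=> //; pose Z := smx Q *m map_mx antipode (map_mx star V) *m smx Qi.
  have YZ : Y *m Z = 1%:M.
    rewrite /Y /Z !mulmxA -(mulmxA _ (smx Qi)) -smxM QiQ smx1 mulmx1.
    rewrite -(mulmxA (smx Q)) corep_antipoder; last exact: bar_corep.
    by rewrite mulmx1 -smxM QQi smx1.
  by rewrite -[starmx Y]mulmx1 -YZ (mulmxA (starmx Y)) sY mul1mx.
- move=> i j; rewrite (antipode2_modular uV _ VDV) => [|k]; last by rewrite gt_eqF.
  congr (_ *: _); rewrite !Dr -[LHS](fmorph_div (real_complex R)) !mxE.
  by congr (_%:C)%C; rewrite -mulf_div divff ?gt_eqF // mul1r expr_div_n !s2.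
by rewrite -UB -mulmxA -smxM BB' smx1 mulmx1.
Qed.

Lemma modular_ind (P : A -> Prop) : P 0 ->
  (forall a b, P a -> P b -> P (a + b)) ->
  (forall c a, P a -> P (c *: a)) ->
  (forall n (V : 'M[A]_n) (q : 'rV[R]_n), unitary_corep V -> irreducible V ->
     (forall i, 0 < q 0 i) -> modular_matrix V (diag_mx (map_mx toC q)) ->
     (forall i j, antipode (antipode (V i j)) =
        ((q 0 i / q 0 j) ^+ 2)%:C%C *: V i j) ->
     forall i j, P (V i j)) ->
  forall a, P a.
Proof.
move=> P0 PD PZ Pm; apply: cqg_ind => //; apply: irreducible_ind => //.
move=> n U i j uU irrU.
have [T [V [q [[uV irrV] qpos mV S2V ->]]]] := modular_diagonalization uU irrU.
by apply: smx_mul_ind => // k l; apply: (Pm n V q).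
Qed.

(** Both S^2 and tau_t multiply a coefficient u_ij of the corepresentations of
    modular_ind by a function of q_i / q_j. When q_i = q_j both fix it. Otherwise
    the factor of S^2 differs from 1, and so does that of tau_t for some t: each
    ideal contains u_ij. *)
Lemma scaling_ideal (tau : R -> {lrmorphism A -> A}) : scaling_group tau ->
  kac_ideal A = ideal_gen (\bigcup_(s in [set: R]) range (fun a : A => tau s a - a)).
Proof.
case=> _ _ _ tauE; set J := ideal_gen _.
have idJ : two_sided_ideal J by apply: ideal_genP.
have idK := kac_idealP A.
have [J0 JD _ _] := idJ; have [K0 KD _ _] := idK.
apply/seteqP; split; apply: ideal_gen_sub => //.
  move=> _ [a _ <-] /=; elim/modular_ind: a => [|a b Ja Jb|c a Ja|].
  - by rewrite !raddf0 addr0.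
  - by rewrite !raddfD /= addrACA; apply: JD.
  - by rewrite !linearZ /= -scalerDr; apply: (ideal_scale idJ).
  move=> n V q uV irrV qpos mV S2V i j; rewrite S2V.
  have [qE|qNE] := eqVneq (q 0 i / q 0 j) 1.
    by rewrite qE expr1n rmorph1 scale1r subrr.
  suff JV : J (V i j).
    by rewrite -[X in _ - X]scale1r -scalerBl; apply: (ideal_scale idJ).
  (* the time at which tau_t changes the sign of u_ij *)
  pose t := pi / ln (q 0 i / q 0 j).
  have qq : 0 < q 0 i / q 0 j by rewrite divr_gt0.
  have ln0 : ln (q 0 i / q 0 j) != 0 by rewrite ln_eq0.
  have : J (tau t (V i j) - V i j).
    by apply: sub_ideal_gen; exists t => //; exists (V i j).
  rewrite (tauE n V q uV irrV mV) /cpow_it /t divfK // cospi sinpi oppr0.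
  have -> : Complex (-1) 0 = -1 :> R[i] by apply/eqP; rewrite eq_complex /= oppr0 !eqxx.
  rewrite scaleN1r -opprD -mulr2n -scaler_nat -scaleNr.
  move=> /(ideal_scale idJ (- 2%:R)^-1); rewrite scalerA mulVf ?scale1r //.
  by rewrite oppr_eq0 pnatr_eq0.
move=> _ [t _ [a _ <-]] /=; elim/modular_ind: a => [|a b Ka Kb|c a Ka|].
- by rewrite !raddf0 addr0.
- by rewrite !raddfD /= addrACA; apply: KD.
- by rewrite !linearZ /= -scalerDr; apply: (ideal_scale idK).
move=> n V q uV irrV qpos mV S2V i j; rewrite (tauE n V q uV irrV mV).
have [qE|qNE] := eqVneq (q 0 i / q 0 j) 1.
  rewrite qE /cpow_it ln1 mulr0 cos0 sin0 oppr0.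
  have -> : Complex 1 0 = 1 :> R[i] by [].
  by rewrite scale1r subrr.
suff KV : kac_ideal A (V i j).
  by rewrite -[X in _ - X]scale1r -scalerBl; apply: (ideal_scale idK).
have := kac_ideal_gen (V i j); rewrite S2V -[X in _ - X]scale1r -scalerBl.
set z := (_ - 1) => Kz.
have z0 : z != 0.
  rewrite /z subr_eq0 -[1](rmorph1 (real_complex R)) (inj_eq (@complexI R)).
  by rewrite sqrp_eq1 // divr_ge0 // ltW.
by have := ideal_scale idK z^-1 Kz; rewrite scalerA mulVf // scale1r.
Qed.
End ModularMatrix.

Theorem lemma3p9 (R : realType) (A : cqgType R) :
  [/\ hopf_star_ideal (kac_ideal A),
      exists (K : cqgType R) (pi : {lrmorphism A -> K}),
        maximal_kac pi /\ mker pi = kac_ideal A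
    & forall tau : R -> {lrmorphism A -> A}, scaling_group tau ->
        kac_ideal A =
        ideal_gen (\bigcup_(s in [set: R]) range (fun a : A => tau s a - a))].
Proof.
split; [exact: kac_hopf_star_ideal|exact: kac_maximal|exact: scaling_ideal].
Qed.
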